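(* Let $d,n\in\mathbb{N}$, $q\in(-1,1)$, let $\varepsilon=(\varepsilon(1),\dots,\varepsilon(2n))\in\mathcal{D}_{(1,* )}(2n)$ be a tuple with the Dyck property, let $\chi=(\chi(1),\dots,\chi(2n))\in\{\ell,r\}^{2n}$, and let $u_1,\dots,u_{2n}\in\mathbb{C}^d$. Consider the operator $$M:=S_{\chi(2n)}^{\varepsilon(2n)}(u_{2n})\cdots S_{\chi(1)}^{\varepsilon(1)}(u_1)\in B(\mathcal{T}_{d;q}).$$ Then $$M(\xi_{\mathrm{vac}})=\sum_{\pi\in\Phi_\chi^{-1}(\varepsilon)}\Bigl[q^{\mathrm{cr}(\pi)}\cdot\prod_{\substack{\{k,h\}\text{ pair in }\underline{s}_\chi\cdot\pi\\ \text{with }\varepsilon(h)=*,\ \varepsilon(k)=1}}\langle u_k,u_h\rangle\Bigr]\cdot\xi_{\mathrm{vac}}.$$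
   Context: $\mathbb{N}=\{1,2,3,\dots\}$; inner products are linear in the first variable; $0^0=1$. $q$-Fock space. For $n\in\mathbb{N}$, equip $(\mathbb{C}^d)^{\otimes n}$ with the inner product determined by $\langle v_1\otimes\cdots\otimes v_n, w_1\otimes\cdots\otimes w_n\rangle_q=\sum_{\tau\in S_n} q^{\iota(\tau)}\prod_{i=1}^n\langle v_i,w_{\tau(i)}\rangle$, where $\iota(\tau)$ is the number of inversions of $\tau$ (this is known to be an inner product; here $S_n$ is the symmetric group). $\mathcal{T}_{d;q}$ is the Hilbert space orthogonal direct sum $\mathbb{C}\oplus\bigoplus_{n\ge1}(\mathbb{C}^d)^{\otimes n}$; the vector $1\in\mathbb{C}$ is the vacuum vector $\xi_{\mathrm{vac}}$. For $v\in\mathbb{C}^d$, the left and right $q$-creation operators $S_\ell(v)=L(v)$ and $S_r(v)=R(v)$ in $B(\mathcal{T}_{d;q})$ are the (bounded) operators determined by $L(v)\xi_{\mathrm{vac}}=v=R(v)\xi_{\mathrm{vac}}$, $L(v)(v_1\otimes\cdots\otimes v_n)=v\otimes v_1\otimes\cdots\otimes v_n$, $R(v)(v_1\otimes\cdots\otimes v_n)=v_1\otimes\cdots\otimes v_n\otimes v$. For $c\in\{\ell,r\}$, $S_c^1(v)=S_c(v)$ and $S_c^*(v)$ is the adjoint of $S_c(v)$. Combinatorics. $\mathcal{P}_2(2n)$ is the set of pair-partitions of $\{1,\dots,2n\}$ (partitions into $n$ blocks of size 2). Two distinct blocks of $\pi\in\mathcal{P}_2(2n)$ cross if, writing their union as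 $\{a<b<c<d\}$, one block is $\{a,c\}$ and the other $\{b,d\}$; $\mathrm{cr}(\pi)$ is the number of unordered pairs of crossing blocks. Write $\chi^{-1}(\ell)=\{i_1<\cdots<i_p\}$ and $\chi^{-1}(r)=\{j_1<\cdots<j_m\}$ with $m=2n-p$. $\underline{s}_\chi$ is the permutation of $\{1,\dots,2n\}$ sending $1,2,\dots,p,p+1,\dots,2n-1,2n$ respectively to $i_1,i_2,\dots,i_p,j_m,\dots,j_2,j_1$. It acts on $\mathcal{P}_2(2n)$ by $\underline{s}_\chi\cdot\{V_1,\dots,V_n\}=\{\underline{s}_\chi(V_1),\dots,\underline{s}_\chi(V_n)\}$. $\mathcal{D}_{(1,* )}(2n)$ is the set of $\varepsilon:\{1,\dots,2n\}\to\{1,*\}$ with $|\{i\le h:\varepsilon(i)=1\}|\ge|\{i\le h:\varepsilon(i)=*\}|$ for all $1\le h\le2n$, with equality for $h=2n$. The map $\Phi_\chi:\mathcal{P}_2(2n)\to\mathcal{D}_{(1,* )}(2n)$ sends $\pi$ to the tuple $\varepsilon$ defined as follows: writing $\underline{s}_\chi\cdot\pi=\{W_1,\dots,W_n\}$, $\varepsilon(\min W_i)=1$ and $\varepsilon(\max W_i)=*$ for all $1\le i\le n$. *)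

(* Defs.v *)
(* The positions 1, ..., 2n are represented by the elements of ['I_(2 * n)],
   that is, shifted down by one. *)
From HB Require Import structures.
From mathcomp Require Import all_boot all_order all_algebra all_fingroup.
From mathcomp Require Import complex.
From mathcomp Require Import boolp functions reals topology normedtype sequences.

Set Implicit Arguments.
Unset Strict Implicit.
Unset Printing Implicit Defensive.

Import Order.TTheory GRing.Theory Num.Theory.
Import numFieldNormedType.Exports.

Local Open Scope ring_scope.
Local Open Scope complex_scope.

Inductive side := Lft | Rgt.
Inductive exponent := One | Star.

Fact is_lftK : cancel (fun c => if c is Lft then true else false)
                      (fun b : bool => if b then Lft else Rgt).
Proof. by case. Qed.
Fact is_oneK : cancel (fun e => if e is One then true else false)
                      (fun b : bool => if b then One else Star).
Proof. by case. Qed.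

HB.instance Definition _ := hasDecEq.Build side (inj_eqAxiom (can_inj is_lftK)).
HB.instance Definition _ :=
  hasDecEq.Build exponent (inj_eqAxiom (can_inj is_oneK)).

Definition cdot (R : realType) (d : nat) (v w : 'rV[R[i]]_d) : R[i] :=
  \sum_(i < d) v 0 i * (w 0 i)^*.

Definition inversions (n : nat) (s : 'S_n) : nat :=
  #|[set ij : 'I_n * 'I_n | (ij.1 < ij.2)%N && (s ij.2 < s ij.1)%N]|.

(* The n-th tensor power of C^d in coordinates: [f t] is the coefficient of the
   basis tensor e_(t 0) (x) ... (x) e_(t (n-1)).  For n = 0 this is C. *)
Definition tensor (R : realType) (d n : nat) : Type :=
  {ffun {ffun 'I_n -> 'I_d} -> R[i]}.

Definition etensor (R : realType) (d n : nat) (v : 'I_n -> 'rV[R[i]]_d) :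
    tensor R d n :=
  [ffun t : {ffun 'I_n -> 'I_d} => \prod_(i < n) v i 0 (t i)].

(* The sesquilinear extension of the q-inner product of basis tensors, where
   <e_a, e_b> = (a == b); its values on all elementary tensors are given by
   [qdot_etensor]. *)
Definition qdot (R : realType) (d : nat) (q : R) (n : nat)
    (f g : tensor R d n) : R[i] :=
  \sum_s \sum_t f s * (g t)^* *
    \sum_(tau : 'S_n) (q ^+ inversions tau)%:C *
      \prod_(i < n) (s i == t (tau i))%:R.

Lemma qdot_etensor (R : realType) (d : nat) (q : R) (n : nat)
    (v w : 'I_n -> 'rV[R[i]]_d) :
  qdot q (etensor v) (etensor w) =
  \sum_(tau : 'S_n) (q ^+ inversions tau)%:C *
    \prod_(i < n) cdot (v i) (w (tau i)).
Proof.
rewrite /qdot.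
under eq_bigr => s _ do under eq_bigr => t _ do rewrite mulr_sumr.
under eq_bigr => s _ do rewrite exchange_big /=.
rewrite exchange_big /=; apply: eq_bigr => tau _.
rewrite /cdot bigA_distr_bigA mulr_sumr /=; apply: eq_bigr => s _.
pose t0 : {ffun 'I_n -> 'I_d} := [ffun i => s ((tau^-1)%g i)].
have t0P t : (t == t0) = [forall i, s i == t (tau i)].
  apply/eqP/forallP => [-> i|st]; first by rewrite ffunE permK.
  by apply/ffunP => i; rewrite ffunE (eqP (st _)) permKV.
rewrite (bigD1 t0) //= [X in _ + X]big1 ?addr0 => [|t]; last first.
  rewrite t0P negb_forall => /existsP[i /negPf sti].
  by rewrite (bigD1 i) //= sti mul0r !mulr0.
rewrite [\prod_(i < n) _%:R]big1 ?mulr1; last first.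
  by move=> i _; rewrite ffunE permK eqxx.
rewrite mulrC !ffunE big_split /= rmorph_prod /=; congr (_ * (_ * _)).
rewrite (reindex_inj (@perm_inj _ tau)) /=.
by apply: eq_bigr => i _; rewrite ffunE permK.
Qed.

Definition sqsummable (R : realType) (d : nat) (q : R)
    (f : forall n, tensor R d n) : Prop :=
  cvgn (series (fun n => complex.Re (qdot q (f n) (f n)))).

(* The Hilbert space direct sum of the tensor powers, n >= 0. *)
Record fock (R : realType) (d : nat) (q : R) := Fock {
  component :> forall n, tensor R d n;
  component_sqsummable : sqsummable q component }.

Definition fdot (R : realType) (d : nat) (q : R) (f g : fock d q) : R[i] :=
  limn (series (fun n => complex.Re (qdot q (f n) (g n)))) +i*
  limn (series (fun n => complex.Im (qdot q (f n) (g n)))).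

Definition vac_seq (R : realType) (d n : nat) : tensor R d n :=
  if n is 0 then [ffun=> 1] else 0.

Fact vac_sqsummable (R : realType) (d : nat) (q : R) :
  sqsummable q (@vac_seq R d).
Proof.
rewrite /sqsummable -(is_cvg_series_restrict 1).
apply: (@is_cvg_near_cst _ _ 0); exists 1%N => // n _ /=.
rewrite big_nat big1 // => -[|k] // _ /=.
rewrite /qdot big1 // => s _; apply: big1 => t _.
by rewrite ffunE !mul0r.
Qed.

Definition vac (R : realType) (d : nat) (q : R) : fock d q :=
  Fock (@vac_sqsummable R d q).

Fact scale_sqsummable (R : realType) (d : nat) (q : R) (a : R[i])
    (f : fock d q) : sqsummable q (fun n => a *: f n).
Proof.
case: f => f /= sf; rewrite /sqsummable.
pose N : R := complex.Re a ^+ 2 + complex.Im a ^+ 2.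
pose w : R ^nat := fun n => complex.Re (qdot q (f n) (f n)).
suff -> : (fun n => complex.Re (qdot q (a *: f n) (a *: f n))) = N *: w.
  exact: is_cvg_seriesZ.
apply/funext => n; rewrite /N /w {sf N w}.
have -> : qdot q (a *: f n) (a *: f n) = (a * a^*) * qdot q (f n) (f n).
  rewrite /qdot mulr_sumr; apply: eq_bigr => s _.
  rewrite mulr_sumr; apply: eq_bigr => t _.
  by rewrite !ffunE rmorphM /= mulrACA !mulrA.
rewrite [RHS]/GRing.scale /=.
case: a => x y; case: (qdot _ _ _) => z w /=.
by rewrite !mulrN opprK (mulrC y x) addNr mul0r subr0 -!expr2.
Qed.

Definition fscale (R : realType) (d : nat) (q : R) (a : R[i]) (f : fock d q) :
    fock d q :=
  Fock (@scale_sqsummable R d q a f).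

Definition create (R : realType) (d : nat) (c : side) (v : 'rV[R[i]]_d)
    (n : nat) (f : tensor R d n) : tensor R d n.+1 :=
  let k : 'I_n.+1 := if c is Lft then ord0 else ord_max in
  [ffun t : {ffun 'I_n.+1 -> 'I_d} => v 0 (t k) * f [ffun i => t (lift k i)]].

Lemma create_Lft (R : realType) (d n : nat) (v : 'I_n.+1 -> 'rV[R[i]]_d) :
  create Lft (v ord0) (etensor (fun i => v (lift ord0 i))) = etensor v.
Proof.
apply/ffunP => t; rewrite !ffunE big_ord_recl; congr (_ * _).
by apply: eq_bigr => i _; rewrite ffunE.
Qed.

Lemma create_Rgt (R : realType) (d n : nat) (v : 'I_n.+1 -> 'rV[R[i]]_d) :
  create Rgt (v ord_max) (etensor (fun i => v (lift ord_max i))) = etensor v.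
Proof.
apply/ffunP => t; rewrite !ffunE big_ord_recr /= mulrC; congr (_ * _).
apply: eq_bigr => i _; rewrite ffunE.
by congr (v _ 0 (t _)); apply/val_inj; rewrite /= /bump leqNgt ltn_ord.
Qed.

Definition create_seq (R : realType) (d : nat) (c : side) (v : 'rV[R[i]]_d)
    (f : forall n, tensor R d n) (n : nat) : tensor R d n :=
  if n is m.+1 then create c v (f m) else 0.

(* For -1 < q < 1 the creation operators are bounded, hence the value 0 in the
   second branch is never used. *)
Definition creation (R : realType) (d : nat) (q : R) (c : side)
    (v : 'rV[R[i]]_d) (f : fock d q) : fock d q :=
  if pselect (sqsummable q (create_seq c v f)) is left h
  then Fock h else fscale 0 f.

Definition is_adjoint (R : realType) (d : nat) (q : R)
    (A B : fock d q -> fock d q) : Prop :=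
  forall f g, fdot (A f) g = fdot f (B g).

(* The adjoint of a bounded operator, which exists and is unique; the value 0 is
   used only for maps without adjoint. *)
Definition adjoint (R : realType) (d : nat) (q : R)
    (A : fock d q -> fock d q) : fock d q -> fock d q :=
  if pselect (exists B, is_adjoint A B) is left h
  then projT1 (cid h) else fscale 0.

Definition S_op (R : realType) (d : nat) (q : R) (c : side) (e : exponent)
    (v : 'rV[R[i]]_d) : fock d q -> fock d q :=
  if e is One then creation c v else adjoint (creation c v).

(* The product S_(m) ... S_(1): the operator of index 0 is applied first. *)
Definition S_word (R : realType) (d : nat) (q : R) (m : nat)
    (chi : 'I_m -> side) (eps : 'I_m -> exponent) (u : 'I_m -> 'rV[R[i]]_d)
    (f : fock d q) : fock d q :=
  foldl (fun g i => S_op (chi i) (eps i) (u i) g) f (enum 'I_m).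

Definition pair_partitions (m : nat) : {set {set {set 'I_m}}} :=
  [set P | finset.partition P [set: 'I_m] & [forall V in P, #|V| == 2]].

Definition crosses (m : nat) (V W : {set 'I_m}) : bool :=
  [exists a : 'I_m, exists b : 'I_m, exists c : 'I_m, exists e : 'I_m,
    [&& (a < b)%N, (b < c)%N, (c < e)%N &
      (V == [set a; c]) && (W == [set b; e]) ||
      (V == [set b; e]) && (W == [set a; c])]].

Definition cr (m : nat) (P : {set {set 'I_m}}) : nat :=
  #|[set [set VW.1; VW.2] | VW in [set VW : {set 'I_m} * {set 'I_m} |
      [&& VW.1 \in P, VW.2 \in P & crosses VW.1 VW.2]]]|.

Definition s_seq (m : nat) (chi : 'I_m -> side) : seq 'I_m :=
  [seq i <- enum 'I_m | chi i == Lft] ++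
  rev [seq i <- enum 'I_m | chi i == Rgt].

Fact s_seq_perm (m : nat) (chi : 'I_m -> side) :
  perm_eq (s_seq chi) (enum 'I_m).
Proof.
have R_L i : (chi i == Rgt) = predC (fun j => chi j == Lft) i.
  by rewrite /=; case: (chi i).
rewrite /s_seq (eq_filter R_L) perm_sym -(perm_filterC (fun j => chi j == Lft)).
by rewrite perm_cat2l perm_sym perm_rev.
Qed.

Fact s_inj (m : nat) (chi : 'I_m -> side) :
  injective (fun k : 'I_m => nth k (s_seq chi) k).
Proof.
have ss : size (s_seq chi) = m by rewrite (perm_size (s_seq_perm chi)) size_enum_ord.
move=> j k; rewrite (set_nth_default k) ?ss // => /eqP.
rewrite nth_uniq ?ss ?(perm_uniq (s_seq_perm chi)) ?enum_uniq //.
by move=> /eqP/val_inj.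
Qed.

(* The permutation sending 1, ..., 2n to i_1, ..., i_p, j_m, ..., j_1. *)
Definition s_perm (m : nat) (chi : 'I_m -> side) : 'S_m := perm (@s_inj m chi).

Definition s_act (m : nat) (chi : 'I_m -> side) (P : {set {set 'I_m}}) :
    {set {set 'I_m}} :=
  [set s_perm chi @: (V : {set 'I_m}) | V in P].

Definition dyck (m : nat) (eps : 'I_m -> exponent) : Prop :=
  (forall h : nat, (1 <= h <= m)%N ->
     (#|[set i : 'I_m | (i < h)%N && (eps i == Star)]| <=
      #|[set i : 'I_m | (i < h)%N && (eps i == One)]|)%N) /\
  #|[set i : 'I_m | eps i == Star]| = #|[set i : 'I_m | eps i == One]|.

(* On a pair partition each position is either the minimum or the maximum of its
   block in [s_act chi P]. *)
Definition Phi (m : nat) (chi : 'I_m -> side) (P : {set {set 'I_m}}) (i : 'I_m) :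
    exponent :=
  if [exists W in s_act chi P, (i \in W) && [forall j in W, (i <= j)%N]]
  then One else Star.

Definition Phi_fiber (m : nat) (chi : 'I_m -> side) (eps : 'I_m -> exponent) :
    {set {set {set 'I_m}}} :=
  [set P in pair_partitions m | [forall i, Phi chi P i == eps i]].

(* Main.v *)
(** Positivity of the q-inner product: with [I s] the inversion set of [s], the
    kernel [q ^ #|I s (+) I t|] is a restriction of a tensor power of the matrix
    ((1, q), (q, 1)), hence strictly positive definite.  Together with the relation
    [l* l = |v|^2 + q l l*] this bounds the creation operators, and by
    non-degeneracy the adjoint is the explicit annihilation operator, which
    removes the letter at position [k] of an elementary tensor with weight
    [q ^ k], [k] being counted from the side at which the operator acts.

    Expanding the word on the vacuum gives a sum over the matchings of the
    creators with the annihilators.  At any time the letters used so far form an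
    interval in the left-to-right order of the tensor, and the annihilator about
    to act is an end point of it; so the letters it jumps over are exactly the
    openers of the blocks that cross its own block and are closed later.
    Crossings do not change when the order given by [s_perm] is replaced by the
    order of the letters: the two differ by a reversal and a cyclic rotation. *)
Require Import Defs.
From mathcomp Require Import all_boot all_order all_algebra all_fingroup.
From mathcomp Require Import complex zify ring lra.
From mathcomp Require Import boolp reals topology normedtype sequences.

Set Implicit Arguments.
Unset Strict Implicit.
Unset Printing Implicit Defensive.

Import Order.TTheory GRing.Theory Num.Theory.
Import numFieldNormedType.Exports.

(** * Matchings and crossings *)

Section Histories.
Variables (m : nat) (chi : 'I_m -> side) (eps : 'I_m -> exponent).
Implicit Types (a b h k : 'I_m) (s w : seq 'I_m) (p : 'I_m * 'I_m)
  (M : seq ('I_m * 'I_m)).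

Definition earlier : rel 'I_m := fun a b => a < b.
Definition opener : pred 'I_m := fun a => eps a == One.
Definition closer : pred 'I_m := fun a => eps a == Star.

Lemma closerN a : closer a = ~~ opener a.
Proof. by rewrite /closer /opener; case: (eps a). Qed.

(* The order in which the letters [a], [b] occur, from left to right, in the
   tensors produced by the word. *)
Definition leftof : rel 'I_m := fun a b =>
  match chi a, chi b with
  | Lft, Lft => b < a
  | Rgt, Rgt => a < b
  | Lft, Rgt => true
  | Rgt, Lft => false
  end.

Definition push h s : seq 'I_m := if chi h is Lft then h :: s else rcons s h.

(** Here [s] holds the open letters in tensor order and [w] the positions still to come. The
    recursion copies the action of the operators on elementary tensors, so that [word_etens] follows
    by the same induction; pairs are recorded in order of closing. *)
Fixpoint matchings w s : seq (seq ('I_m * 'I_m)) :=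
  if w is h :: w' then
    if opener h then matchings w' (push h s)
    else [seq (k, h) :: M | k <- s, M <- matchings w' (rem k s)]
  else if s is [::] then [:: [::]] else [::].

(** The invariant of the recursion in [matchings]: it makes the place of a letter in [s] computable
    from [leftof] alone. *)
Definition consistent s w :=
  [&& pairwise leftof s, pairwise earlier w & allrel earlier s w].

Lemma leftof_irr : irreflexive leftof.
Proof. by move=> a; rewrite /leftof; case: (chi a); rewrite ltnn. Qed.

Lemma leftof_trans : transitive leftof.
Proof.
move=> b a c; rewrite /leftof; case: (chi a); case: (chi b); case: (chi c) => //; lia.
Qed.

Lemma consistent_uniq s w : consistent s w -> uniq s.
Proof. by case/and3P => /(pairwise_uniq leftof_irr). Qed.

Lemma consistent_push h w s : consistent s (h :: w) -> consistent (push h s) w.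
Proof.
case/and3P => ps; rewrite pairwise_cons => /andP[hw pw].
rewrite allrel_consr => /andP[/allP sh sw].
rewrite /consistent pw /push; case E: (chi h).
  rewrite pairwise_cons ps allrel_consl hw sw !andbT; apply/allP => a /sh.
  by rewrite /earlier /leftof E; case: (chi a).
rewrite pairwise_rcons ps andbT -cats1 allrel_catl sw allrel1l hw !andbT.
by apply/allP => a /sh; rewrite /earlier /leftof E; case: (chi a).
Qed.

Lemma consistent_rem h k w s : consistent s (h :: w) -> consistent (rem k s) w.
Proof.
case/and3P => ps; rewrite pairwise_cons => /andP[hw pw].
rewrite allrel_consr => /andP[_ /allrelP sw].
rewrite /consistent pw (subseq_pairwise (rem_subseq _ _) ps) /=.
by apply/allrelP => a b /mem_rem; apply: sw.
Qed.

Lemma perm_push h s : perm_eq (push h s) (h :: s).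
Proof. by rewrite /push; case: (chi h); rewrite ?perm_rcons. Qed.

(** A description of [matchings] without recursion. Fixing the order of the closers leaves only one
    list for each matching. *)
Definition is_matching w s M :=
  [&& unzip2 M == [seq a <- w | closer a],
      perm_eq (unzip1 M) (s ++ [seq a <- w | opener a]) &
      all (fun p => earlier p.1 p.2) M].

Lemma mem_matchings w s M : consistent s w ->
  (M \in matchings w s) = is_matching w s M.
Proof.
elim: w s M => [|h w IH] s M c.
  rewrite /is_matching /= cats0; case: M => [|p M]; last by case: s {c}.
  by case: s {c} => [|a s]; rewrite ?perm_refl //= perm_sym; case: perm_nilP.
rewrite /is_matching /= closerN; case: ifP => oh /=.
  rewrite IH ?consistent_push // /is_matching; congr [&& _, _ & _].
  have /permPr -> // : perm_eq (push h s ++ [seq a <- w | opener a])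
                              (s ++ h :: [seq a <- w | opener a]).
  apply/seq.permP => x; rewrite !count_cat (seq.permP (perm_push h s)) /=.
  by rewrite addnCA addnA.
pose W := [seq a <- w | opener a]; rewrite -/W.
have perm_s k : k \in s -> perm_eq (s ++ W) (k :: rem k s ++ W).
  by move=> ks; rewrite -cat_cons perm_cat2r perm_to_rem.
apply/allpairsPdep/and3P => [[k [M' [ks]]]|].
  rewrite IH ?(consistent_rem k c) // => /and3P[/eqP M2 M1 Mk] -> /=; split.
  - by rewrite M2.
  - by rewrite (permPr (perm_s k ks)) /= perm_cons.
  - rewrite Mk andbT.
    by case/and3P: c => _ _ /allrelP; apply=> //; rewrite mem_head.
case: M => [|[k h'] M] [] // /eqP[-> /eqP M2] M1 /= /andP[kh Mk].
(* An opener still in [w] comes after [h], so [h] cannot close it. *)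
have ks : k \in s.
  have : k \in s ++ W by rewrite -(perm_mem M1) mem_head.
  rewrite mem_cat mem_filter => /orP[//|/andP[_ kw]].
  case/and3P: c => _ /= /andP[/allP /(_ _ kw)] + _ _.
  by rewrite /earlier in kh *; lia.
exists k, M; split=> //; rewrite IH ?(consistent_rem k c) //; apply/and3P; split=> //.
by rewrite -(perm_cons k) -(permPr (perm_s k ks)).
Qed.

Lemma matchings_uniq w s : consistent s w -> uniq (matchings w s).
Proof.
elim: w s => [|h w IH] s c /=; first by case: s {c}.
case: ifP => _; first exact/IH/consistent_push.
apply: allpairs_uniq_dep => [|k _|]; first exact: consistent_uniq c.
  exact/IH/(consistent_rem k c).
by move=> [k M] [k' M'] _ _ /= [-> ->].
Qed.

(* For [p] closed before [p']: the blocks cross when [p'] is open while [p] is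
   being closed and its opener lies between the end of the tensor at which
   [p.2] acts and the letter [p.1]. *)
Definition crossing p p' : bool :=
  (p'.1 < p.2) && (if chi p.2 is Lft then leftof p'.1 p.1 else leftof p.1 p'.1).

Fixpoint count_pairs (T : Type) (r : rel T) (L : seq T) : nat :=
  if L is x :: L' then count (r x) L' + count_pairs r L' else 0.

(** In a list increasing for a strict order, the entries before [x] are exactly those below [x]. *)
Lemma index_count (T : eqType) (r : rel T) (L : seq T) x :
  irreflexive r -> transitive r -> pairwise r L -> x \in L ->
  index x L = count (r^~ x) L.
Proof.
move=> irr tr pL xL; case/path.splitPr: xL pL => L1 L2.
rewrite pairwise_cat pairwise_cons allrel_consr => /and4P[/andP[L1x _] _ xL2 _].
have nr y : r x y -> r y x = false.
  by move=> xy; apply/negP => /(tr _ _ _ xy); rewrite irr.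
have xL1 : x \notin L1 by apply/negP => /(allP L1x); rewrite irr.
rewrite index_cat (negPf xL1) /= eqxx addn0 count_cat /= irr.
move: L1x; rewrite all_count => /eqP ->.
rewrite (@eq_in_count _ _ pred0 L2) ?count_pred0 ?addn0 // => y /(allP xL2).
exact: nr.
Qed.

(** The exponent of [q] produced when [h] closes [k]. Blocks whose opener is still in [w] open after
    [h] and do not count; an opener in [s] counts when it lies between [k] and the end where [h]
    acts. As [s] is ordered, their number is the place of [k] counted from that end. *)
Lemma count_crossing h w s k M : consistent s (h :: w) -> k \in s ->
  M \in matchings w (rem k s) ->
  count (crossing (k, h)) M =
  if chi h is Lft then index k s else size s - (index k s).+1.
Proof.
move=> c ks; rewrite mem_matchings ?(consistent_rem k c) // => /and3P[_ M1 _].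
pose side a := if chi h is Lft then leftof a k else leftof k a.
have -> : count (crossing (k, h)) M =
    count (fun a => (a < h) && side a) (unzip1 M).
  by rewrite count_map; apply: eq_count.
rewrite (seq.permP M1) count_cat [X in _ + X](@eq_in_count _ _ pred0); last first.
  move=> a; rewrite mem_filter => /andP[_ aw] /=; case/and3P: c => _ /= + _.
  by case/andP => /allP/(_ _ aw); rewrite /earlier => ha _; rewrite ltnNge ltnW.
rewrite count_pred0 addn0 (@eq_in_count _ _ side); last first.
  move=> a /mem_rem as_; case/and3P: c => _ _ /allrelP/(_ _ h as_) /=.
  by rewrite mem_head /earlier => ->.
(* The letter [k] can be put back without changing the count, since [leftof] is irreflexive. *)
have -> : count side (rem k s) = count side s.
  by rewrite (seq.permP (perm_to_rem ks)) /= /side; case: (chi h); rewrite leftof_irr.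
rewrite /side; case/and3P: c => ps _ _; case: (chi h).
  by rewrite (index_count leftof_irr leftof_trans ps ks).
case/path.splitPr: ks ps => s1 s2; rewrite pairwise_cat pairwise_cons allrel_consr.
case/and4P => /andP[s1k _] _ ks2 _; rewrite count_cat /= leftof_irr.
have nleft a b : leftof a b -> leftof b a = false.
  by move=> ab; apply/negP => /(leftof_trans ab); rewrite leftof_irr.
rewrite (@eq_in_count _ _ pred0 s1) ?count_pred0; last first.
  by move=> a /(allP s1k)/nleft.
have ks1 : k \notin s1 by apply/negP => /(allP s1k); rewrite leftof_irr.
rewrite index_cat (negPf ks1) /= eqxx size_cat /= addn0 addnS subSS addKn.
by apply/eqP; rewrite -all_count.
Qed.
End Histories.

(** * Crossings in the order given by [s_perm] *)

Lemma pairwise_rev (T : Type) (r : rel T) (L : seq T) :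
  pairwise r (rev L) = pairwise (fun x y => r y x) L.
Proof. by elim: L => //= x L IH; rewrite rev_cons pairwise_rcons all_rev IH. Qed.

Section Crossings.
Variables (m : nat) (chi : 'I_m -> side).
Implicit Types (a b k h : 'I_m) (p : 'I_m * 'I_m).

(** The order in which [s_seq] lists the positions. It is obtained from [leftof] by a reversal,
    followed by moving the left positions in front of the right ones. *)
Definition srel : rel 'I_m := fun a b =>
  match chi a, chi b with
  | Lft, Lft => a < b
  | Rgt, Rgt => b < a
  | Lft, Rgt => true
  | Rgt, Lft => false
  end.

Lemma enum_ord_pairwise : pairwise (@earlier m) (enum 'I_m).
Proof.
rewrite -(pairwise_map (fun a : 'I_m => a : nat) ltn) val_enum_ord.
by rewrite -(sorted_pairwise ltn_trans) iota_ltn_sorted.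
Qed.

Lemma s_seq_pairwise : pairwise srel (s_seq chi).
Proof.
have filt (P : pred 'I_m) : pairwise (@earlier m) [seq i <- enum 'I_m | P i].
  by rewrite pairwise_filter // enum_ord_pairwise.
have Eall c : all (fun i => chi i == c) [seq i <- enum 'I_m | chi i == c].
  by apply/allP => i; rewrite mem_filter => /andP[].
rewrite /s_seq pairwise_cat; apply/and3P; split.
- apply/allrelP => a b; rewrite mem_rev !mem_filter /srel.
  by move=> /andP[/eqP -> _] /andP[/eqP -> _].
- apply: sub_in_pairwise (filt _); last exact: Eall.
  by move=> a b /eqP + /eqP; rewrite /srel => -> ->.
rewrite pairwise_rev; apply: sub_in_pairwise (filt _); last exact: Eall.
by move=> a b /eqP + /eqP; rewrite /srel => -> ->.
Qed.

(** The list [s_seq] is increasing for [srel], so [s_perm] is an order isomorphism onto the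
    positions ordered by [srel]. *)
Lemma s_perm_lt a b : ((s_perm chi)^-1%g a < (s_perm chi)^-1%g b) = srel a b.
Proof.
set s := s_perm chi.
have ss : size (s_seq chi) = m by rewrite (perm_size (s_seq_perm chi)) size_enum_ord.
have mono (i j : 'I_m) : i < j -> srel (s i) (s j).
  have nthE k : s k = nth i (s_seq chi) k.
    by rewrite /s permE; apply: set_nth_default; rewrite ss.
  rewrite !nthE => ij; have /(pairwiseP i) := s_seq_pairwise.
  by apply; rewrite ?inE ?ss ?ltn_ord.
rewrite -[in RHS](permKV s a) -[in RHS](permKV s b).
move: (s^-1%g a) (s^-1%g b) => i j.
have [/mono -> //|/mono|/val_inj ->] := ltngtP i j.
  by rewrite /srel; case: (chi _); case: (chi _) => //; lia.
by rewrite /srel; case: (chi _); rewrite ltnn.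
Qed.

Lemma set2_eq (T : finType) (x y a b : T) : x != y -> [set x; y] = [set a; b] ->
  (x = a /\ y = b) \/ (x = b /\ y = a).
Proof.
move=> xy E; have := set21 x y; have := set22 x y; rewrite {}E !inE.
case/orP=> /eqP yE /orP[] /eqP xE; subst; rewrite ?eqxx // in xy; by [left|right].
Qed.

(** Each inner sum modulo 2 regroups to the test whether [z], or [t], lies between [x] and [y]; the
    pairs cross when exactly one of the two does. In this form crossing is a matter of boolean
    arithmetic on comparisons. *)
Lemma crosses_set2 (x y z t : 'I_m) : uniq [:: x; y; z; t] ->
  crosses [set x; y] [set z; t] =
  (((x < z) (+) (y < z)) (+) ((x < t) (+) (y < t))).
Proof.
rewrite /= !inE !negb_or ?andbT.
case/and3P => /and3P[xy xz xt] /andP[yz yt] zt.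
have neq (a b : 'I_m) : a != b -> a <> b :> nat by move=> /eqP ab /val_inj.
have nxy := neq _ _ xy; have nxz := neq _ _ xz; have nxt := neq _ _ xt.
have nyz := neq _ _ yz; have nyt := neq _ _ yt; have nzt := neq _ _ zt.
apply/existsP/idP => [[a /existsP[b /existsP[c /existsP[e]]]]|].
  case/and4P => ab bc ce; case/orP => /andP[/eqP/(set2_eq xy) E /eqP/(set2_eq zt) F];
  by case: E => -[? ?]; case: F => -[? ?]; subst; lia.
(* Sorting each pair provides the four witnesses; the only choice left is which pair starts
   first. *)
pose lo (i j : 'I_m) := if i < j then i else j.
pose hi (i j : 'I_m) := if i < j then j else i.
have lohi (i j : 'I_m) : [set lo i j; hi i j] = [set i; j].
  by rewrite /lo /hi; case: ifP => // _; rewrite setUC.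
rewrite -(lohi x y) -(lohi z t) => X.
have [c|c] := ltnP (lo x y) (lo z t).
  exists (lo x y); apply/existsP; exists (lo z t); apply/existsP; exists (hi x y).
  apply/existsP; exists (hi z t); rewrite !eqxx orTb andbT c /=.
  by move: X c; rewrite /lo /hi; do 2!case: ifP => ?; lia.
exists (lo z t); apply/existsP; exists (lo x y); apply/existsP; exists (hi z t).
apply/existsP; exists (hi x y); rewrite !eqxx orbT andbT.
by move: X c; rewrite /lo /hi; do 2!case: ifP => ?; lia.
Qed.

(** A matching pairs positions in time, which gives blocks of [s_act chi P]; the blocks of [P]
    itself are their preimages under [s_perm]. *)
Definition block p : {set 'I_m} := [set (s_perm chi)^-1%g i | i in [set p.1; p.2]].

Lemma blockE p : block p = [set (s_perm chi)^-1%g p.1; (s_perm chi)^-1%g p.2].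
Proof. by rewrite /block imsetU !imset_set1. Qed.

(* Crossing is invariant under reversal and rotation of the order.  The letters
   used up to time [p.2] form an interval of the left-to-right order; [p.2] is an
   end point of it and [p'.2] lies outside, so only [p'.1] decides. *)
Lemma crosses_block p p' : p.1 < p.2 -> p'.1 < p'.2 -> p.2 < p'.2 ->
  p.1 != p'.1 -> p.2 != p'.1 ->
  crosses (block p) (block p') = crossing chi p p'.
Proof.
case: p p' => [k h] [k' h'] /= kh kh' hh' nk nh.
have neq (a b : 'I_m) : a < b -> a != b by move=> ab; rewrite neq_ltn ab.
rewrite !blockE crosses_set2 /=; last first.
  rewrite !inE !negb_or !(inj_eq perm_inj) nk nh !neq //.
  exact: ltn_trans kh hh'.
have {}nk : k <> k' :> nat by move=> /val_inj/eqP; rewrite (negPf nk).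
have {}nh : h <> k' :> nat by move=> /val_inj/eqP; rewrite (negPf nh).
rewrite !s_perm_lt /crossing /srel /leftof /=.
by case: (chi k); case: (chi h); case: (chi k'); case: (chi h'); lia.
Qed.

(** Induction on [L]: the unordered pairs from [y :: L] that contain [y] are disjoint from those
    inside [L], because [y] is not in [L]. *)
Lemma card_crossing_pairs (T : finType) (r : rel T) (L : seq T) :
  symmetric r -> irreflexive r -> uniq L ->
  #|[set [set x.1; x.2] | x in [set x : T * T |
      [&& x.1 \in L, x.2 \in L & r x.1 x.2]]]| = count_pairs r L.
Proof.
move=> sym irr; elim: L => [|y L IH] /=.
  by move=> _; apply/eqP; rewrite cards_eq0 -subset0; apply/subsetP => V
    /imsetP[x]; rewrite inE.
case/andP => yL uL; rewrite -{}IH // -size_filter.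
have -> : size [seq x <- L | r y x] = #|[set [set y; x] | x in [set x in L | r y x]]|.
  rewrite card_in_imset => [|x x']; last first.
    rewrite !inE => /andP[xL _] _ E.
    have xy : y != x by apply: contraNneq yL => ->.
    by case: (set2_eq xy E) => -[// e1 e2]; rewrite -e1 -e2 eqxx in xy *.
  rewrite -(card_uniqP (filter_uniq (r y) uL)); apply: eq_card => x.
  by rewrite inE mem_filter andbC.
rewrite -cardsUI [X in _ = _ + X]eq_card0 ?addn0; last first.
  move=> V; rewrite inE; apply/negP => /andP[/imsetP[x]].
  rewrite inE => /andP[xL yx] -> /imsetP[[a b]]; rewrite inE /= => /and3P[aL bL _].
  have := set21 y x => + E; rewrite {}E !inE => /orP[] /eqP E; subst;
  by rewrite (aL, bL) in yL.
apply: eq_card => V; rewrite !inE; apply/imsetP/orP => [[[a b]]|[]].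
- rewrite !inE /= => /and3P[/orP[/eqP ->|aL] /orP[/eqP ->|bL] ab] ->.
  + by rewrite irr in ab.
  + by left; apply/imsetP; exists b; rewrite // inE bL.
  + by left; apply/imsetP; exists a; rewrite ?inE ?aL 1?sym // setUC.
  + by right; apply/imsetP; exists (a, b); rewrite // inE /= aL bL.
- case/imsetP => x; rewrite inE => /andP[xL yx] ->.
  by exists (y, x); rewrite // !inE /= eqxx xL orbT.
- case/imsetP => [[a b]]; rewrite inE /= => /and3P[aL bL ab] ->.
  by exists (a, b); rewrite // !inE /= aL bL !orbT.
Qed.

Lemma crosses_sym : symmetric (@crosses m).
Proof.
move=> V W; rewrite /crosses.
apply: eq_existsb => a; apply: eq_existsb => b; apply: eq_existsb => c.
by apply: eq_existsb => e; rewrite orbC ![(W == _) && _]andbC.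
Qed.

Lemma crosses_irr : irreflexive (@crosses m).
Proof.
have neq (i j : 'I_m) : i < j -> i != j by move=> ij; rewrite neq_ltn ij.
move=> V; case E: (crosses V V) => //.
case/existsP: E => [a /existsP[b /existsP[c /existsP[e]]]].
case/and4P => ab bc ce; case/orP => /andP[/eqP -> /eqP].
  move/(set2_eq (neq _ _ (ltn_trans ab bc))).
  by case=> -[E1 E2]; subst; lia.
move/(set2_eq (neq _ _ (ltn_trans bc ce))).
by case=> -[E1 E2]; subst; lia.
Qed.

End Crossings.

(** * Bijection between matchings and the fibre of [Phi] *)

Lemma uniq_map_inj (T1 T2 : eqType) (f : T1 -> T2) (L : seq T1) :
  uniq (map f L) -> {in L &, injective f}.
Proof.
elim: L => //= z L IH /andP[/negP zL /IH inj] x y; rewrite !inE.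
case/orP => [/eqP ->|xL] /orP[/eqP ->|yL] // fxy; last exact: inj.
- by case: zL; rewrite fxy map_f.
- by case: zL; rewrite -fxy map_f.
Qed.

Lemma count_pairs_map (T1 T2 : Type) (f : T1 -> T2) (r : rel T2) (L : seq T1) :
  count_pairs r (map f L) = count_pairs (fun x y => r (f x) (f y)) L.
Proof. by elim: L => //= x L ->; rewrite count_map. Qed.

Lemma eq_count_pairs (T : eqType) (r r' : rel T) (L : seq T) :
  pairwise (fun x y => r x y == r' x y) L -> count_pairs r L = count_pairs r' L.
Proof.
elim: L => //= x L IH /andP[/allP xL /IH ->]; congr (_ + _).
by apply: eq_in_count => y /xL /eqP.
Qed.

Section MatchingPartition.
Variables (m : nat) (chi : 'I_m -> side) (eps : 'I_m -> exponent).
Implicit Types (i j k h : 'I_m) (p : 'I_m * 'I_m) (M : seq ('I_m * 'I_m))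
  (P Q : {set {set 'I_m}}).

Definition partition_of M : {set {set 'I_m}} := [set block chi p | p in M].
Definition pairs_of M : {set {set 'I_m}} := [set [set p.1; p.2] | p in M].

Lemma s_act_partition_of M : s_act chi (partition_of M) = pairs_of M.
Proof.
rewrite /s_act /partition_of /pairs_of -imset_comp; apply: eq_imset => p /=.
by rewrite blockE imsetU !imset_set1 !permKV.
Qed.

Lemma s_act_inj : injective (s_act chi).
Proof. by apply: imset_inj; apply: imset_inj; apply: perm_inj. Qed.

Lemma pair_partitions_act P :
  (s_act chi P \in pair_partitions m) = (P \in pair_partitions m).
Proof.
have inj := @perm_inj _ (s_perm chi).
rewrite !inE -(imset_partition P setT inj); congr (finset.partition _ _ && _).
  by apply/setP => i; rewrite inE; apply/esym/imsetP; exists ((s_perm chi)^-1%g i);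
    rewrite ?permKV.
apply/forall_inP/forall_inP => c V VP.
  by rewrite -(card_imset _ inj) c // imset_f.
by case/imsetP: VP => W WP ->; rewrite card_imset ?c.
Qed.

Lemma consistent_nil : consistent chi [::] (enum 'I_m).
Proof.
by rewrite /consistent enum_ord_pairwise; apply/allrelP.
Qed.

Section FromMatching.
Variable M : seq ('I_m * 'I_m).
Hypothesis vM : is_matching eps (enum 'I_m) [::] M.

Let M2 : unzip2 M = [seq a <- enum 'I_m | closer eps a].
Proof. by case/and3P: vM => /eqP. Qed.

Let M1 : perm_eq (unzip1 M) [seq a <- enum 'I_m | opener eps a].
Proof. by case/and3P: vM. Qed.

Lemma matching_lt p : p \in M -> p.1 < p.2.
Proof. by case/and3P: vM => _ _ /allP; apply. Qed.

Lemma matching_inj1 : {in M &, injective fst}.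
Proof.
by apply: uniq_map_inj; rewrite -/(unzip1 M) (perm_uniq M1) filter_uniq // enum_uniq.
Qed.

Lemma matching_inj2 : {in M &, injective snd}.
Proof. by apply: uniq_map_inj; rewrite -/(unzip2 M) M2 filter_uniq // enum_uniq. Qed.

Lemma matching_opener i : opener eps i = (i \in unzip1 M).
Proof. by rewrite (perm_mem M1) mem_filter mem_enum andbT. Qed.

Lemma matching_closer i : closer eps i = (i \in unzip2 M).
Proof. by rewrite M2 mem_filter mem_enum andbT. Qed.

Lemma matching1 p : p \in M -> opener eps p.1.
Proof. by move=> pM; rewrite matching_opener map_f. Qed.

Lemma matching2 p : p \in M -> closer eps p.2.
Proof. by move=> pM; rewrite matching_closer map_f. Qed.

Lemma matching_neq p p' : p \in M -> p' \in M -> p.1 != p'.2.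
Proof.
move=> /matching1 + /matching2; rewrite closerN => + o.
by apply: contraTneq => ->.
Qed.

Lemma matching_share p p' i : p \in M -> p' \in M ->
  i \in [set p.1; p.2] -> i \in [set p'.1; p'.2] -> p = p'.
Proof.
move=> pM p'M; rewrite !inE => /orP[] /eqP -> /orP[] /eqP.
- exact: matching_inj1.
- by move/eqP; rewrite (negPf (matching_neq pM p'M)).
- by move/esym/eqP; rewrite (negPf (matching_neq p'M pM)).
- exact: matching_inj2.
Qed.

Lemma matching_uniq : uniq M.
Proof.
by apply: (@map_uniq _ _ snd); rewrite -/(unzip2 M) M2 filter_uniq // enum_uniq.
Qed.

Lemma matching_pairwise : pairwise (fun p p' => p.2 < p'.2) M.
Proof.
rewrite -(pairwise_map snd (@earlier m)) -/(unzip2 M) M2.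
by rewrite pairwise_filter // enum_ord_pairwise.
Qed.

Lemma pairs_of_partition : pairs_of M \in pair_partitions m.
Proof.
rewrite inE; apply/andP; split; last first.
  apply/forall_inP => W /imsetP[p pM ->].
  by rewrite cards2 (matching_neq pM pM).
apply/and3P; split.
- apply/eqP/setP => i; rewrite inE; apply/bigcupP.
  have : opener eps i || closer eps i by rewrite closerN orbN.
  rewrite matching_opener matching_closer.
  case/orP => /mapP[p pM ->]; exists [set p.1; p.2];
    by [exact: imset_f | rewrite !inE eqxx ?orbT].
- apply/trivIsetP => _ _ /imsetP[p pM ->] /imsetP[p' p'M ->].
  move=> ne; apply/pred0P => i /=; apply: contraNF ne => /andP[ip ip'].
  by rewrite (matching_share pM p'M ip ip').
- apply/imsetP => -[p _ /setP/(_ p.1)]; by rewrite !inE eqxx.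
Qed.

(** Each opener precedes its closer, so the minima of the blocks in [pairs_of M] are exactly the
    openers. *)
Lemma partition_of_fiber : partition_of M \in Phi_fiber chi eps.
Proof.
rewrite inE -pair_partitions_act s_act_partition_of pairs_of_partition.
apply/forallP => i; rewrite /Phi s_act_partition_of.
have -> : [exists W in pairs_of M, (i \in W) && [forall j in W, i <= j]] =
          opener eps i.
  apply/exists_inP/idP => [[_ /imsetP[p pM ->]]|].
    rewrite !inE => /andP[/orP[] /eqP ->]; first by rewrite matching1.
    move=> /forall_inP/(_ p.1); rewrite !inE eqxx => /(_ isT).
    by rewrite leqNgt matching_lt.
  rewrite matching_opener => /mapP[p pM ->]; exists [set p.1; p.2].
    exact: imset_f.
  rewrite !inE eqxx; apply/forall_inP => j; rewrite !inE => /orP[] /eqP -> //.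
  exact/ltnW/matching_lt.
by rewrite /opener; case: (eps i).
Qed.

(** The list [M] is sorted by closers, so [count_pairs] meets each two blocks with the one closed
    first in front, as [crosses_block] requires. *)
Lemma cr_partition_of : cr (partition_of M) = count_pairs (crossing chi) M.
Proof.
have injb : {in M &, injective (block chi)}.
  move=> p p' pM p'M; rewrite /block => /(imset_inj (@perm_inj _ _)) E.
  by apply: (matching_share pM p'M (i := p.1)); rewrite -?E ?inE eqxx.
transitivity (count_pairs (@crosses m) (map (block chi) M)).
  have uL : uniq (map (block chi) M) by rewrite map_inj_in_uniq // matching_uniq.
  rewrite -(card_crossing_pairs (@crosses_sym m) (@crosses_irr m) uL) /cr.
  have mem X : (X \in partition_of M) = (X \in map (block chi) M).
    by apply/imsetP/mapP => -[p pM ->]; exists p.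
  suff -> : [set VW : {set 'I_m} * {set 'I_m} | [&& VW.1 \in partition_of M,
        VW.2 \in partition_of M & crosses VW.1 VW.2]] =
      [set VW : {set 'I_m} * {set 'I_m} | [&& VW.1 \in map (block chi) M,
        VW.2 \in map (block chi) M & crosses VW.1 VW.2]] by [].
  by apply/setP => -[V W]; rewrite !inE /= !mem.
rewrite count_pairs_map; apply: eq_count_pairs.
apply: (sub_in_pairwise (P := [in M]) _ _ matching_pairwise); last exact/allP.
move=> p p' pM p'M pp'; apply/eqP.
apply: crosses_block; rewrite ?matching_lt //.
  apply: contraTneq pp' => /(matching_inj1 pM p'M) ->.
  by rewrite ltnn.
by rewrite eq_sym matching_neq.
Qed.

(** The values of [eps] orient an unordered block, so the partition determines the members of [M].
    This gives injectivity and also identifies the index set of the product in the theorem. *)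
Lemma mem_pairs_of p :
  [&& [set p.1; p.2] \in pairs_of M, closer eps p.2 & opener eps p.1] = (p \in M).
Proof.
apply/and3P/idP => [[/imsetP[p' p'M E] c o]|pM]; last first.
  by split; [exact: imset_f | exact: matching2 | exact: matching1].
have ne : p'.1 != p'.2 by rewrite matching_neq.
case: (set2_eq ne (esym E)) => -[e1 e2].
  by case: p p' p'M e1 e2 {E c o ne} => [a b] [a' b'] /= + <- <-.
by move: o; rewrite -e2 -[opener _ _]negbK -closerN matching2.
Qed.

End FromMatching.

Lemma matchingE M :
  (M \in matchings chi eps (enum 'I_m) [::]) = is_matching eps (enum 'I_m) [::] M.
Proof. exact/mem_matchings/consistent_nil. Qed.

Lemma partition_of_inj :
  {in matchings chi eps (enum 'I_m) [::] &, injective partition_of}.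
Proof.
move=> M M'; rewrite !matchingE => vM vM' /(congr1 (s_act chi)).
rewrite !s_act_partition_of => E.
(* Both lists are sorted by closers, so it suffices that they have the same members. *)
apply: (irr_sorted_eq (leT := fun p p' => p.2 < p'.2)).
- by move=> p p' p''; apply: ltn_trans.
- by move=> p; apply: ltnn.
- by rewrite sorted_pairwise ?(matching_pairwise vM) // => p p' p''; apply: ltn_trans.
- by rewrite sorted_pairwise ?(matching_pairwise vM') // => p p' p''; apply: ltn_trans.
by move=> p; rewrite -(mem_pairs_of vM) E (mem_pairs_of vM').
Qed.

Section FromPartition.
Variable P : {set {set 'I_m}}.
Hypothesis fP : P \in Phi_fiber chi eps.
Let Q := s_act chi P.

Let pQ : Q \in pair_partitions m.
Proof. by move: fP; rewrite inE pair_partitions_act => /andP[]. Qed.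

Let partQ : finset.partition Q setT.
Proof. by move: pQ; rewrite inE => /andP[]. Qed.

Lemma pair_share V W i : V \in Q -> W \in Q -> i \in V -> i \in W -> V = W.
Proof.
case/and3P: partQ => _ /trivIsetP tQ _ VQ WQ iV iW; apply/eqP.
apply: contraT => /(tQ _ _ VQ WQ); rewrite -setI_eq0 => /eqP/setP/(_ i).
by rewrite !inE iV iW.
Qed.

(** The default [i] is never taken: [partnerP] finds a second element in the block of [i]. *)
Definition partner i := odflt i [pick j | (j != i) && ([set j; i] \in Q)].

Lemma partnerP i : partner i != i /\ [set partner i; i] \in Q.
Proof.
rewrite /partner; case: pickP => [j /andP[]//|none] /=.
have /bigcupP[W WQ iW] : i \in cover Q by case/and3P: partQ => /eqP -> _ _; rewrite inE.
move: pQ; rewrite inE => /andP[_ /forall_inP/(_ W WQ)/cards2P[x [y [xy WE]]]].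
move: iW WQ; rewrite {}WE !inE => /orP[] /eqP ix xyQ.
  by have := none y; rewrite ix eq_sym xy finset.setUC xyQ.
by have := none x; rewrite ix xy xyQ.
Qed.

Lemma partner_eq i j : j != i -> [set j; i] \in Q -> j = partner i.
Proof.
have [pi piQ] := partnerP i => ji jiQ.
have E : [set j; i] = [set partner i; i].
  by apply: (pair_share jiQ piQ (i := i)); rewrite !inE eqxx orbT.
by case: (set2_eq ji E) => -[// e _]; rewrite e eqxx in ji.
Qed.

Lemma partnerK : involutive partner.
Proof.
move=> i; have [pi piQ] := partnerP i; apply/esym/partner_eq.
  by rewrite eq_sym.
by rewrite finset.setUC.
Qed.

Lemma opener_partner i : opener eps i = (i < partner i).
Proof.
have [pi piQ] := partnerP i.
move: fP; rewrite inE => /andP[_ /forallP/(_ i)]; rewrite /opener => /eqP <-.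
rewrite /Phi -/Q; have -> : [exists W in Q, (i \in W) && [forall j in W, i <= j]] =
    (i < partner i).
  apply/exists_inP/idP => [[W WQ /andP[iW]]|lt].
    rewrite (pair_share WQ piQ iW) ?inE ?eqxx ?orbT //.
    move=> /forall_inP/(_ (partner i)); rewrite !inE eqxx => /(_ isT).
    by rewrite leq_eqVlt => /orP[/eqP/val_inj e|//]; rewrite -e eqxx in pi.
  exists [set partner i; i] => //; rewrite !inE eqxx orbT /=.
  by apply/forall_inP => j; rewrite !inE => /orP[] /eqP -> //; apply: ltnW.
by case: ifP.
Qed.

Lemma closer_partner i : closer eps i = (partner i < i).
Proof.
rewrite closerN opener_partner -leqNgt leq_eqVlt; case: eqP => // /val_inj e.
by have [] := partnerP i; rewrite e eqxx.
Qed.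

(** Pair each closer, in increasing order, with its partner; the involution [partner] exchanges
    openers and closers, so every opener occurs once. *)
Lemma partition_of_surj :
  exists2 M, M \in matchings chi eps (enum 'I_m) [::] & partition_of M = P.
Proof.
pose M := [seq (partner h, h) | h <- enum 'I_m & closer eps h].
exists M.
  rewrite matchingE; apply/and3P; split.
  - by rewrite /unzip2 -map_comp map_id.
  - rewrite /unzip1 -map_comp; apply: uniq_perm.
    + by rewrite (map_inj_uniq (can_inj partnerK)) filter_uniq ?enum_uniq.
    + by rewrite filter_uniq ?enum_uniq.
    move=> k; rewrite mem_filter mem_enum andbT opener_partner.
    apply/mapP/idP => [[h]|lt].
      by rewrite mem_filter closer_partner => /andP[lt _] -> /=; rewrite partnerK.
    exists (partner k); last by rewrite /= partnerK.
    by rewrite mem_filter mem_enum closer_partner partnerK lt.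
  - apply/allP => _ /mapP[h + ->] /=.
    by rewrite mem_filter closer_partner => /andP[].
apply: s_act_inj; rewrite s_act_partition_of -/Q; apply/setP => W.
apply/imsetP/idP => [[_ /mapP[h _ ->] ->]|WQ]; first by case: (partnerP h).
move: pQ; rewrite inE => /andP[_ /forall_inP/(_ W WQ)/cards2P[x [y [xy WE]]]].
wlog lt : x y xy WE / x < y => [wlogxy|].
  have [lt|lt|/val_inj e] := ltngtP x y; first exact: wlogxy lt.
    by apply: wlogxy lt; rewrite 1?eq_sym // finset.setUC.
  by rewrite e eqxx in xy.
have xE : x = partner y by apply: partner_eq; rewrite // -WE.
exists (x, y) => //; apply/mapP; exists y; last by rewrite -xE.
by rewrite mem_filter mem_enum closer_partner -xE lt.
Qed.

End FromPartition.

Lemma perm_Phi_fiber :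
  perm_eq (enum (Phi_fiber chi eps))
          (map partition_of (matchings chi eps (enum 'I_m) [::])).
Proof.
apply: uniq_perm; first exact: enum_uniq.
  rewrite map_inj_in_uniq; last exact: partition_of_inj.
  exact/matchings_uniq/consistent_nil.
move=> P; rewrite mem_enum; apply/idP/mapP => [/partition_of_surj[M vM <-]|[M + ->]].
  by exists M.
by rewrite matchingE => /partition_of_fiber.
Qed.

End MatchingPartition.

(** * Positivity of the q-inner product *)

Local Open Scope complex_scope.
(* Opened last so that [x^*] is always [Num.conj]. *)
Local Open Scope ring_scope.

Definition invset (n : nat) (s : 'S_n) : {set 'I_n * 'I_n} :=
  [set ij : 'I_n * 'I_n | (ij.1 < ij.2)%N && (s ij.2 < s ij.1)%N].

(** An inversion of [s^-1 * t] is a pair of values of [s] whose positions are ordered one way by [s]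
    and the other way by [t]. The map [f] sends such a pair of values to the sorted pair of
    positions. *)
Lemma inversionsMV (n : nat) (s t : 'S_n) :
  inversions (s^-1 * t)%g =
  #|(invset s :\: invset t) :|: (invset t :\: invset s)|.
Proof.
pose f (ij : 'I_n * 'I_n) : 'I_n * 'I_n :=
  let a := (s^-1)%g ij.1 in let b := (s^-1)%g ij.2 in
  if (a < b)%N then (a, b) else (b, a).
rewrite /inversions -(@card_in_imset _ _ f).
  apply: eq_card => -[i j]; rewrite !inE /=.
  apply/imsetP/idP => [[[a b]] | H].
    rewrite inE /= !permM => /andP[ab tba].
    rewrite /f /=; case: ltngtP => [lt|gt|/val_inj/perm_inj eqab] [-> ->].
    - by rewrite !permKV; lia.
    - by rewrite !permKV; lia.
    - by rewrite eqab ltnn in ab.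
  have ij : (i < j)%N by lia.
  have [sij|] := boolP (s i < s j)%N.
    exists (s i, s j); last by rewrite /f /= !permK ij.
    by rewrite inE /= sij !permM !permK; lia.
  rewrite -leqNgt leq_eqVlt => /orP[/eqP/val_inj/perm_inj eq|sji].
    by rewrite eq ltnn in ij.
  have [tij|] := boolP (t i < t j)%N.
    exists (s j, s i); last by rewrite /f /= !permK ltnNge (ltnW ij).
    by rewrite inE /= sji !permM !permK.
  rewrite -leqNgt leq_eqVlt => /orP[/eqP/val_inj/perm_inj eq|tji].
    by rewrite eq ltnn in ij.
  by lia.
move=> [a b] [c e]; rewrite !inE /= => /andP[ab _] /andP[ce _].
rewrite /f /=; case: ifP => _; case: ifP => _ [] /perm_inj h1 /perm_inj h2; subst => //.
  by rewrite ltnNge (ltnW ab) in ce.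
by rewrite ltnNge (ltnW ab) in ce.
Qed.

Lemma inversionsV (n : nat) (s : 'S_n) : inversions (s^-1)%g = inversions s.
Proof.
rewrite -[(s^-1)%g]mulg1 inversionsMV setUC -inversionsMV.
by rewrite invg1 mul1g.
Qed.

Lemma sum_ltn_ord (n k : nat) : (k <= n)%N -> (\sum_(j < n) (j < k) = k)%N.
Proof.
move=> kn; rewrite -big_mkcond /= -(big_ord_widen_cond _ xpredT (fun=> 1%N) kn) /=.
by rewrite sum1_card card_ord.
Qed.

(* The inversion set determines, for each [i], how many values lie below [s i],
   that is, [s i] itself. *)
Lemma invset_inj (n : nat) : injective (@invset n).
Proof.
move=> s t st; apply/permP => i; apply/val_inj.
have card_below (r : 'S_n) : #|[set j : 'I_n | (r j < r i)%N]| = r i.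
  rewrite -[RHS](sum_ltn_ord (ltnW (ltn_ord (r i)))) -sum1dep_card big_mkcond /=.
  by rewrite [RHS](reindex_inj (@perm_inj _ r)); apply: eq_bigr => j _; case: ifP.
rewrite /= -(card_below s) -(card_below t); apply: eq_card => j; rewrite !inE.
have [ji|ij|/val_inj ->] := ltngtP j i; last by rewrite !ltnn.
  have := congr1 (fun A : {set _} => (j, i) \in A) st; rewrite !inE /= ji /=.
  have ne (r : 'S_n) : nat_of_ord (r j) <> r i.
    by move=> /val_inj/perm_inj e; rewrite e ltnn in ji.
  by have := ne s; have := ne t; lia.
by have := congr1 (fun A : {set _} => (i, j) \in A) st; rewrite !inE /= ij.
Qed.

Lemma inversions_sum (n : nat) (s : 'S_n) :
  inversions s = (\sum_(i < n) \sum_(j < n) ((i < j) && (s j < s i)))%N.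
Proof.
rewrite pair_bigA /= -big_mkcond /= sum1dep_card; apply: eq_card => ij.
by rewrite !inE.
Qed.

(** Position 0 takes the value [k], so it is inverted with the [k] positions carrying smaller
    values; the other inversions are those of [s]. *)
Lemma inversions_lift_perm0 (n : nat) (k : 'I_n.+1) (s : 'S_n) :
  inversions (lift_perm ord0 k s) = (k + inversions s)%N.
Proof.
rewrite !inversions_sum big_ord_recl; congr (_ + _)%N.
  rewrite big_ord_recl ltnn add0n.
  under eq_bigr => j _ do rewrite lift_perm_id lift_perm_lift /=.
  rewrite (reindex_inj (@perm_inj _ (s^-1)%g)) /=.
  under eq_bigr => j _ do rewrite permKV.
  transitivity (\sum_(j < n) (j < k))%N.
    apply: eq_bigr => j _; rewrite /= /bump; congr nat_of_bool.
    by case: (leqP k j); lia.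
  by rewrite sum_ltn_ord // -ltnS.
apply: eq_bigr => i _; rewrite big_ord_recl /= add0n.
apply: eq_bigr => j _; rewrite !lift_perm_lift /= /bump !leq0n !add1n ltnS.
congr (nat_of_bool (_ && _)); case: (leqP k (s i)); case: (leqP k (s j)); lia.
Qed.

Lemma inversions_rev (n : nat) (s t : 'S_n) :
  (forall i, t i = rev_ord (s (rev_ord i))) -> inversions t = inversions s.
Proof.
move=> ts; rewrite !inversions_sum exchange_big /=.
rewrite (reindex_inj rev_ord_inj) /=; apply: eq_bigr => i _.
rewrite (reindex_inj rev_ord_inj) /=; apply: eq_bigr => j _.
rewrite !ts !rev_ordK /=; congr (nat_of_bool (_ && _)).
  by have := ltn_ord i; have := ltn_ord j; lia.
by have := ltn_ord (s i); have := ltn_ord (s j); lia.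
Qed.

Lemma conj_real_complex (R : rcfType) (x : R) : (x%:C)^* = x%:C.
Proof. exact: conjc_real. Qed.

Lemma real_complex_ge0 (R : rcfType) (x : R) : (0 <= x%:C) = (0 <= x).
Proof. by rewrite lecR. Qed.

(** * Strict positivity of the symmetric difference kernel *)

Definition symdiff (T : finType) (A B : {set T}) : {set T} :=
  (A :\: B) :|: (B :\: A).

(** A product of entries of the row (0, 1) at the points of [C] and of the row (1, q) elsewhere, the
    column at [p] being chosen by whether [p] lies in [A]. *)
Definition psi (K : nzRingType) (T : finType) (q : K) (C A : {set T}) : K :=
  \prod_(p : T) (if p \in C then (p \in A)%:R else q ^+ (p \in A)).

(* The 2 x 2 matrix ((1, q), (q, 1)) is (1, q)^T (1, q) + (1 - q^2) (0, 1)^T (0, 1);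
   the kernel is a tensor power of it. *)
Lemma symdiff_kernel (K : comNzRingType) (T : finType) (q : K) (A B : {set T}) :
  q ^+ #|symdiff A B| =
  \sum_(C : {set T}) (1 - q ^+ 2) ^+ #|C| * (psi q C A * psi q C B).
Proof.
pose F p : K := (1 - q ^+ 2) * ((p \in A)%:R * (p \in B)%:R).
pose G p : K := q ^+ (p \in A) * q ^+ (p \in B).
transitivity (\prod_(p : T) (F p + G p)).
  have FG p : F p + G p = if p \in symdiff A B then q else 1.
    rewrite !inE /F /G; case: (p \in A); case: (p \in B) => /=; ring.
  by rewrite (eq_bigr _ (fun p _ => FG p)) -big_mkcond prodr_const.
rewrite bigA_distr; apply: eq_bigr => C _.
rewrite -prodr_const [X in _ = X * _]big_mkcond /= -!big_split /=.
apply: eq_bigr => p _.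
by rewrite /F /G; case: ifP => // _; rewrite mul1r.
Qed.

(** With [psi_diag], this makes [psi] unitriangular for inclusion. *)
Lemma psi_neq0 (K : idomainType) (T : finType) (q : K) (C A : {set T}) :
  psi q C A != 0 -> C \subset A.
Proof.
apply: contraR => /subsetPn[p pC pA].
by rewrite /psi (bigD1 p) //= pC (negPf pA) mul0r.
Qed.

Lemma psi_diag (K : comNzRingType) (T : finType) (q : K) (A : {set T}) :
  psi q A A = 1.
Proof. by rewrite /psi big1 // => p _; case: (p \in A). Qed.

Section KernelForm.
Variables (R : realType) (X I : finType) (q : R) (A : I -> {set X}).
Hypothesis hq : -1 < q < 1.

Let w : R := 1 - q ^+ 2.
Let w_gt0 : 0 < w.
Proof. by have /andP[] := hq; rewrite /w; nra. Qed.

Let y (x : I -> R[i]) (C : {set X}) : R[i] := \sum_s (psi q C (A s))%:C * x s.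

Definition kernel_form (x : I -> R[i]) : R[i] :=
  \sum_s \sum_r (q ^+ #|symdiff (A r) (A s)|)%:C * (x r * (x s)^*).

(** Substituting [symdiff_kernel] diagonalizes the form into squares with the positive weights
    [w ^+ #|C|]. *)
Lemma kernel_formE x :
  kernel_form x = \sum_(C : {set X}) (w ^+ #|C|)%:C * (y x C * (y x C)^*).
Proof.
transitivity (\sum_s \sum_r \sum_(C : {set X})
    (w ^+ #|C|)%:C * (((psi q C (A r))%:C * x r) * ((psi q C (A s))%:C * x s)^*)).
  apply: eq_bigr => s _; apply: eq_bigr => r _.
  rewrite symdiff_kernel rmorph_sum mulr_suml; apply: eq_bigr => C _ /=.
  rewrite -/w !rmorphM /= conj_real_complex; ring.
rewrite [RHS](eq_bigr (fun C : {set X} => \sum_s \sum_r (w ^+ #|C|)%:C *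
    (((psi q C (A r))%:C * x r) * ((psi q C (A s))%:C * x s)^*))).
  rewrite [RHS]exchange_big /=; apply: eq_bigr => s _.
  by rewrite [RHS]exchange_big.
move=> C _; rewrite [X in _ * X]mulrC {1}/y rmorph_sum /= mulr_suml mulr_sumr.
apply: eq_bigr => s _; rewrite /y !mulr_sumr.
by apply: eq_bigr => r _; ring.
Qed.

Lemma kernel_form_ge0 x : 0 <= kernel_form x.
Proof.
rewrite kernel_formE sumr_ge0 // => C _.
by rewrite mulr_ge0 ?mul_conjC_ge0 // real_complex_ge0 exprn_ge0 // ltW.
Qed.

Lemma kernel_form_eq0 x : injective A -> kernel_form x = 0 -> x =1 fun=> 0.
Proof.
move=> injA; rewrite kernel_formE => /eqP.
rewrite psumr_eq0 => [/allP y0 | C _]; last first.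
  by rewrite mulr_ge0 ?mul_conjC_ge0 // real_complex_ge0 exprn_ge0 // ltW.
have {}y0 C : y x C = 0.
  have := y0 C (mem_index_enum _); rewrite /= !mulf_eq0 conjC_eq0 orbb.
  case/orP => [|/eqP //]; rewrite fmorph_eq0 expf_eq0 => /andP[_ /eqP w0].
  by have := w_gt0; rewrite w0 ltxx.
(* All squares vanish. The one at [C = A s] is that of [x s] plus terms at indices [r] with [A s]
   strictly inside [A r], where the complement is smaller and the induction applies. *)
move=> s; have [m] := ubnP #|~: A s|; elim: m s => // m IH s ltm.
have := y0 (A s); rewrite /y (bigD1 s) //= psi_diag mul1r big1 ?addr0 // => r rs.
have [->|/psi_neq0 sub] := eqVneq (psi q (A s) (A r)) 0; first by rewrite mul0r.
rewrite IH ?mulr0 //; apply: (@leq_trans #|~: A s|); last by rewrite -ltnS.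
rewrite proper_card // properC properEneq sub andbT.
by apply: contra_neq rs => /injA.
Qed.
End KernelForm.

Section QDot.
Variables (R : realType) (d : nat) (q : R).
Implicit Type n : nat.

Lemma qdotE n (f g : tensor R d n) :
  qdot q f g = \sum_(tau : 'S_n) (q ^+ inversions tau)%:C *
     \sum_(t : {ffun 'I_n -> 'I_d}) f [ffun i => t (tau i)] * (g t)^*.
Proof.
rewrite /qdot.
under eq_bigr => s _ do under eq_bigr => t _ do rewrite mulr_sumr.
rewrite exchange_big /=.
under eq_bigr => t _ do rewrite exchange_big /=.
rewrite exchange_big /=; apply: eq_bigr => tau _.
rewrite mulr_sumr; apply: eq_bigr => t _.
rewrite (bigD1 [ffun i => t (tau i)]) //= [X in _ + X]big1 ?addr0.
  by rewrite big1 ?mulr1 => [|i _]; [exact: mulrC | rewrite ffunE eqxx].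
move=> s st; have [i /negPf sti] : exists i, s i != t (tau i).
  apply/existsP; apply: contraR st => /existsPn st.
  by apply/eqP/ffunP => i; rewrite ffunE; apply/eqP/negbNE/st.
by rewrite [\prod_(i < n) _](bigD1 i) //= sti mul0r !mulr0.
Qed.

Lemma qdotDl n (f g h : tensor R d n) :
  qdot q (f + g) h = qdot q f h + qdot q g h.
Proof.
rewrite !qdotE -big_split; apply: eq_bigr => tau _ /=.
rewrite -mulrDr -big_split; congr (_ * _); apply: eq_bigr => t _ /=.
by rewrite ffunE mulrDl.
Qed.

Lemma qdotZl n a (f h : tensor R d n) : qdot q (a *: f) h = a * qdot q f h.
Proof.
rewrite !qdotE mulr_sumr; apply: eq_bigr => tau _ /=.
rewrite [RHS]mulrCA [a * _]mulr_sumr; congr (_ * _); apply: eq_bigr => t _ /=.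
by rewrite ffunE mulrA.
Qed.

Lemma qdotC n (f g : tensor R d n) : qdot q g f = (qdot q f g)^*.
Proof.
rewrite !qdotE rmorph_sum (reindex_inj invg_inj) /=; apply: eq_bigr => tau _.
rewrite rmorphM /= conj_real_complex inversionsV rmorph_sum; congr (_ * _).
rewrite (reindex_inj (h := fun t : {ffun 'I_n -> 'I_d} =>
    [ffun i => t (tau i)])) /=.
  apply: eq_bigr => t _; rewrite rmorphM /= conjCK mulrC; congr (_ * _).
  by congr (g _); apply/ffunP => i; rewrite !ffunE permKV.
move=> t t' /ffunP tt'; apply/ffunP => i.
by have := tt' ((tau^-1)%g i); rewrite !ffunE permKV.
Qed.

Lemma qdotDr n (f g h : tensor R d n) :
  qdot q f (g + h) = qdot q f g + qdot q f h.
Proof. by rewrite qdotC qdotDl rmorphD /= -!qdotC. Qed.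

Lemma qdotZr n a (f h : tensor R d n) : qdot q f (a *: h) = a^* * qdot q f h.
Proof. by rewrite qdotC qdotZl rmorphM /= -qdotC. Qed.

Hypothesis hq : -1 < q < 1.

(** Averaging over the symmetric group: replacing [tau] by [r^-1 * s] turns its inversion number
    into a symmetric difference of inversion sets, at the cost of the factor n!. *)
Lemma qdot_kernel n (f : tensor R d n) :
  (\sum_(s : 'S_n) 1) * qdot q f f =
  \sum_(t : {ffun 'I_n -> 'I_d})
    kernel_form q (@invset n) (fun s => f [ffun i => t ((s^-1)%g i)]).
Proof.
rewrite [RHS]exchange_big mulr_suml; apply: eq_bigr => s _; rewrite mul1r.
rewrite exchange_big qdotE /=.
rewrite (reindex_inj (h := fun r : 'S_n => (r^-1 * s)%g)) /=; last first.
  by move=> r r' /mulIg/invg_inj.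
apply: eq_bigr => r _; rewrite inversionsMV -mulr_sumr; congr (_ * _).
rewrite (reindex_inj (h := fun t : {ffun 'I_n -> 'I_d} =>
    [ffun i => t ((s^-1)%g i)])) /=.
  apply: eq_bigr => t _; congr (f _ * _).
  by apply/ffunP => i; rewrite !ffunE permM permK.
move=> t t' /ffunP tt'; apply/ffunP => i.
by have := tt' (s i); rewrite !ffunE permK.
Qed.

Let card_perm_gt0 n : 0 < \sum_(s : 'S_n) 1 :> R[i].
Proof. by rewrite sumr_const ltr0n; apply/card_gt0P; exists 1%g. Qed.

Lemma qdot_ge0 n (f : tensor R d n) : 0 <= qdot q f f.
Proof.
rewrite -(pmulr_rge0 _ (card_perm_gt0 n)) qdot_kernel.
by rewrite sumr_ge0 // => t _; apply: kernel_form_ge0.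
Qed.

Lemma qdot_eq0 n (f : tensor R d n) : qdot q f f = 0 -> f = 0.
Proof.
move=> f0; have /eqP := qdot_kernel f; rewrite f0 mulr0 eq_sym.
rewrite psumr_eq0 => [/allP K0 | t _]; last exact: kernel_form_ge0.
apply/ffunP => t; have /eqP := K0 t (mem_index_enum _).
move=> /(kernel_form_eq0 hq (@invset_inj n))/(_ 1%g); rewrite /= ffunE => <-.
by congr (f _); apply/ffunP => i; rewrite ffunE invg1 perm1.
Qed.
End QDot.

(** * Creation and annihilation *)

Definition insert_at (T : Type) (n : nat) (k : 'I_n.+1) (a : T)
    (t : {ffun 'I_n -> T}) : {ffun 'I_n.+1 -> T} :=
  [ffun i => if unlift k i is Some j then t j else a].

Lemma insert_at_id (T : Type) n (k : 'I_n.+1) (a : T) (t : {ffun 'I_n -> T}) :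
  insert_at k a t k = a.
Proof. by rewrite ffunE unlift_none. Qed.

Lemma insert_at_lift (T : Type) n (k : 'I_n.+1) (a : T) (t : {ffun 'I_n -> T}) j :
  insert_at k a t (lift k j) = t j.
Proof. by rewrite ffunE liftK. Qed.

Lemma sum_insert_at (V : nmodType) (T : finType) (n : nat) (k : 'I_n.+1)
    (F : {ffun 'I_n.+1 -> T} -> V) :
  \sum_t F t = \sum_(a : T) \sum_(t : {ffun 'I_n -> T}) F (insert_at k a t).
Proof.
rewrite pair_bigA /=.
rewrite (reindex (fun p : T * {ffun 'I_n -> T} => insert_at k p.1 p.2)) //=.
apply/onW_bij/inj_card_bij; last by rewrite card_prod !card_ffun !card_ord expnS.
move=> [a t] [b t'] /= /ffunP ab; congr (_, _).
  by have := ab k; rewrite !insert_at_id.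
by apply/ffunP => j; have := ab (lift k j); rewrite !insert_at_lift.
Qed.

Lemma sum_lift_perm (V : nmodType) (n : nat) (i : 'I_n.+1) (F : 'S_n.+1 -> V) :
  \sum_s F s = \sum_(k < n.+1) \sum_(s : 'S_n) F (lift_perm i k s).
Proof.
rewrite pair_bigA /= (reindex (fun p : 'I_n.+1 * 'S_n => lift_perm i p.1 p.2)) //=.
apply/onW_bij/inj_card_bij; last by rewrite card_prod !card_Sn card_ord factS.
move=> [k s] [k' s'] /= /permP ss; have kk : k = k'.
  by have := ss i; rewrite !lift_perm_id.
rewrite kk; congr (_, _); apply/permP => j; have := ss (lift i j).
by rewrite !lift_perm_lift kk => /lift_inj.
Qed.

Section Annihilation.
Variables (R : realType) (d : nat) (q : R).
Implicit Types (n : nat) (v : 'rV[R[i]]_d).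

(** Reversing the tensor factors preserves [qdot] and exchanges the two ends, which reduces the
    right operators to the left ones. *)
Definition flip n (f : tensor R d n) : tensor R d n :=
  [ffun t : {ffun 'I_n -> 'I_d} => f [ffun i => t (rev_ord i)]].

Lemma flipK n : involutive (@flip n).
Proof.
move=> f; apply/ffunP => t; rewrite !ffunE; congr (f _).
by apply/ffunP => i; rewrite !ffunE rev_ordK.
Qed.

Lemma qdot_flip n (f g : tensor R d n) : qdot q (flip f) (flip g) = qdot q f g.
Proof.
pose c (s : 'S_n) : 'S_n :=
  perm (inj_comp rev_ord_inj (inj_comp (@perm_inj _ s) rev_ord_inj)).
have cE s i : c s i = rev_ord (s (rev_ord i)) by rewrite permE.
rewrite !qdotE (reindex_inj (h := c)); last first.
  move=> s s' /permP ss; apply/permP => i.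
  by have := ss (rev_ord i); rewrite !cE rev_ordK => /rev_ord_inj.
apply: eq_bigr => s _; rewrite (inversions_rev (cE s)); congr (_ * _).
rewrite [RHS](reindex_inj (h := fun t : {ffun 'I_n -> 'I_d} =>
    [ffun i => t (rev_ord i)])).
  apply: eq_bigr => t _; rewrite !ffunE; congr (f _ * (g _)^*).
  by apply/ffunP => i; rewrite !ffunE cE rev_ordK.
move=> t t' /ffunP tt; apply/ffunP => i.
by have := tt (rev_ord i); rewrite !ffunE rev_ordK.
Qed.

Lemma qdot_flipl n (f g : tensor R d n) : qdot q (flip f) g = qdot q f (flip g).
Proof. by rewrite -qdot_flip flipK. Qed.

Lemma create_flip n v (f : tensor R d n) :
  create Rgt v f = flip (create Lft v (flip f)).
Proof.
apply/ffunP => t; rewrite !ffunE; congr (v 0 (t _) * f _).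
  by apply/val_inj; rewrite /= subn1.
apply/ffunP => i; rewrite !ffunE; congr (t _); apply/val_inj => /=.
by rewrite /bump; have := ltn_ord i; lia.
Qed.

Definition annihL n v (g : tensor R d n.+1) : tensor R d n :=
  [ffun t : {ffun 'I_n -> 'I_d} => \sum_(k < n.+1) (q ^+ k)%:C *
     \sum_(a < d) (v 0 a)^* * g (insert_at k a t)].

Definition annih (c : side) n v (g : tensor R d n.+1) : tensor R d n :=
  if c is Lft then annihL v g else flip (annihL v (flip g)).

(** Split the permutations of [n.+1] letters by the image [k] of position 0: it contributes the
    weight [q ^ k], and the created letter is paired with the letter of [g] at position [k]. *)
Lemma qdot_create c n v (f : tensor R d n) (g : tensor R d n.+1) :
  qdot q (create c v f) g = qdot q f (annih c v g).
Proof.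
wlog -> : c f g / c = Lft => [wlogL|].
  case: c; first exact: wlogL.
  by rewrite create_flip qdot_flipl wlogL // qdot_flipl.
rewrite !qdotE (sum_lift_perm ord0) exchange_big /=; apply: eq_bigr => s _.
transitivity ((q ^+ inversions s)%:C *
    \sum_(t : {ffun 'I_n -> 'I_d}) \sum_(k < n.+1) (q ^+ k)%:C *
      \sum_(a < d)
        create Lft v f [ffun i => insert_at k a t (lift_perm ord0 k s i)] *
        (g (insert_at k a t))^*).
  rewrite [in RHS]exchange_big mulr_sumr; apply: eq_bigr => k _.
  rewrite inversions_lift_perm0 exprD rmorphM /= -mulrA mulrCA -mulr_sumr.
  by rewrite (sum_insert_at k) exchange_big.
congr (_ * _); apply: eq_bigr => t _.
rewrite [annihL v g t]ffunE rmorph_sum mulr_sumr; apply: eq_bigr => k _.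
rewrite rmorphM /= conj_real_complex rmorph_sum mulrCA !mulr_sumr.
apply: eq_bigr => a _; rewrite rmorphM /= conjCK !ffunE lift_perm_id unlift_none.
set F := [ffun i => _]; have -> : F = [ffun i => t (s i)].
  by apply/ffunP => i; rewrite !ffunE lift_perm_lift liftK.
by rewrite -!mulrA; congr (_ * _); rewrite mulrCA.
Qed.

Lemma annihL_createL0 v (f : tensor R d 0) :
  annihL v (create Lft v f) = cdot v v *: f.
Proof.
apply/ffunP => t; rewrite !ffunE big_ord1 expr0 mul1r [RHS]mulr_suml.
apply: eq_bigr => a _; rewrite !ffunE unlift_none mulrA [X in X * _]mulrC.
by congr (_ * f _); apply/ffunP => -[].
Qed.

(** Removing the letter at position 0 cancels the created one; removing any later letter leaves it
    in place and shifts the exponent by one. *)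
Lemma annihL_createL n v (f : tensor R d n.+1) :
  annihL v (create Lft v f) = cdot v v *: f + q%:C *: create Lft v (annihL v f).
Proof.
apply/ffunP => t; rewrite !ffunE big_ord_recl expr0 mul1r; congr (_ + _).
  rewrite [RHS]mulr_suml; apply: eq_bigr => a _.
  rewrite !ffunE unlift_none mulrA [X in X * _]mulrC; congr (_ * f _).
  by apply/ffunP => i; rewrite !ffunE liftK.
rewrite [RHS]mulrCA [RHS]mulrA mulr_sumr; apply: eq_bigr => k _.
rewrite lift0 exprS rmorphM /= -!mulrA [RHS]mulrCA; congr (_ * _).
rewrite [RHS]mulrCA; congr (_ * _); rewrite mulr_sumr; apply: eq_bigr => a _.
rewrite !ffunE [RHS]mulrCA.
have ins0 : insert_at (lift ord0 k) a t ord0 = t ord0.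
  rewrite ffunE; case: unliftP => [j|//] e; congr (t _); apply/val_inj.
  by have := congr1 val e; rewrite /= /bump; lia.
have insS i : insert_at (lift ord0 k) a t (lift ord0 i) =
    insert_at k a [ffun i => t (lift ord0 i)] i.
  have [j|] := unliftP k i => ->.
    rewrite insert_at_lift ffunE.
    have -> : lift ord0 (lift k j) = lift (lift ord0 k) (lift ord0 j).
      by apply/val_inj; rewrite /= /bump; lia.
    by rewrite liftK ffunE.
  by rewrite !insert_at_id.
rewrite -[in RHS]ins0 ffunE; congr (_ * (v 0 _ * f _)).
by apply/ffunP => i; rewrite ffunE.
Qed.

End Annihilation.

(** * Boundedness of creation and annihilation *)

Section Bounds.
Variables (R : realType) (d : nat) (q : R).
Hypothesis hq : -1 < q < 1.
Implicit Types (n : nat) (v : 'rV[R[i]]_d) (c : side).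

Definition sqn n (f : tensor R d n) : R := complex.Re (qdot q f f).

Lemma ge0_Re (z : R[i]) : 0 <= z -> z = (complex.Re z)%:C.
Proof. by case: z => x y; rewrite lecE /= => /andP[/eqP -> _]. Qed.

Lemma qdot_sqn n (f : tensor R d n) : qdot q f f = (sqn f)%:C.
Proof. exact/ge0_Re/qdot_ge0. Qed.

Lemma sqn_ge0 n (f : tensor R d n) : 0 <= sqn f.
Proof. by rewrite -real_complex_ge0 -qdot_sqn qdot_ge0. Qed.

Lemma sqn_flip n (f : tensor R d n) : sqn (flip f) = sqn f.
Proof. by rewrite /sqn qdot_flip. Qed.

Lemma cdot_ge0 v : 0 <= cdot v v.
Proof. by apply: sumr_ge0 => i _; apply: mul_conjC_ge0. Qed.

Lemma sqn_createL0 v (f : tensor R d 0) :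
  sqn (create Lft v f) = complex.Re (cdot v v) * sqn f.
Proof.
rewrite /sqn qdot_create /= annihL_createL0 qdotZr qdot_sqn.
by rewrite (ge0_Re (cdot_ge0 v)) conj_real_complex -rmorphM.
Qed.

Lemma sqn_createL n v (f : tensor R d n.+1) :
  sqn (create Lft v f) = complex.Re (cdot v v) * sqn f + q * sqn (annihL q v f).
Proof.
rewrite /sqn qdot_create /= annihL_createL qdotDr !qdotZr qdot_sqn.
rewrite [qdot q f (create _ _ _)]qdotC (qdot_create _ Lft) /= qdot_sqn.
by rewrite (ge0_Re (cdot_ge0 v)) !conj_real_complex -!rmorphM -rmorphD.
Qed.

(* Expanding [0 <= |B f - create h|^2] with [h = annih f] and using
   [<f, create h> = |h|^2]. *)
Lemma sqn_annih_le c n v (f : tensor R d n.+1) (B : R) : 0 < B ->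
  sqn (create c v (annih q c v f)) <= B * sqn (annih q c v f) ->
  sqn (annih q c v f) <= B * sqn f.
Proof.
move=> B0; set h := annih q c v f; set g := create c v h => gB.
have := sqn_ge0 (B%:C *: f + (-1)%:C *: g).
rewrite /sqn qdotDl !qdotDr !qdotZl !qdotZr.
rewrite [qdot q f g]qdotC (qdot_create _ c) -/h !qdot_sqn !conj_real_complex.
rewrite -!rmorphM -!rmorphD /= => e.
have {}e : 0 <= B * (B * sqn f - sqn h) by have := gB; lra.
by rewrite -subr_ge0; rewrite pmulr_rge0 in e.
Qed.

(** A constant [B] with [|v|^2 + |q| B <= B], the inequality that closes the induction in
    [sqn_create_le]; the added 1 keeps it positive when [v] is zero. *)
Definition create_bound v : R := (complex.Re (cdot v v) + 1) / (1 - `|q|).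

Lemma create_boundP v : [/\ 0 < create_bound v,
  complex.Re (cdot v v) <= create_bound v &
  complex.Re (cdot v v) + `|q| * create_bound v <= create_bound v].
Proof.
have v0 : 0 <= complex.Re (cdot v v).
  by rewrite -real_complex_ge0 -ge0_Re cdot_ge0.
have q1 : `|q| < 1 by rewrite ltr_norml.
have q0 := normr_ge0 q; set B := create_bound v.
have BE : B * (1 - `|q|) = complex.Re (cdot v v) + 1.
  by rewrite mulfVK // gt_eqF // subr_gt0.
have B0 : 0 < B by rewrite divr_gt0 ?subr_gt0 // ltr_wpDl.
by split => //; nra.
Qed.

(** Induction on the degree: the bound for creation one degree lower bounds annihilation out of the
    present degree by [sqn_annih_le], and [sqn_createL] turns this into the bound for creation. *)
Lemma sqn_create_le c n v (f : tensor R d n) :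
  sqn (create c v f) <= create_bound v * sqn f.
Proof.
wlog -> : c f / c = Lft => [wlogL|].
  case: c; first exact: wlogL.
  by rewrite create_flip sqn_flip -[sqn f]sqn_flip wlogL.
have [B0 vB qB] := create_boundP v.
elim: n f => [|n IH] f.
  by rewrite sqn_createL0 ler_wpM2r ?sqn_ge0.
rewrite sqn_createL; have := sqn_annih_le B0 (IH (annih q Lft v f)) => /= le.
have h0 := sqn_ge0 (annihL q v f); have f0 := sqn_ge0 f.
have qle : q * sqn (annihL q v f) <= `|q| * (create_bound v * sqn f).
  apply: le_trans (ler_wpM2r h0 (ler_norm q)) _.
  exact: ler_wpM2l.
apply: le_trans (lerD (lexx _) qle) _.
by rewrite mulrA -mulrDl ler_wpM2r.
Qed.

End Bounds.

(** * Operators on the Fock space and their adjoints *)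

Section Sequences.
Local Open Scope classical_set_scope.
Variables (R : realType) (d : nat) (q : R).
Hypothesis hq : -1 < q < 1.
Implicit Types (n : nat) (v : 'rV[R[i]]_d) (c : side).

Definition annih_seq c v (f : forall n, tensor R d n) n : tensor R d n :=
  annih q c v (f n.+1).

Lemma fock_eq (f g : fock d q) : (forall n, f n = g n) -> f = g.
Proof.
case: f g => f hf [g hg] /= fg.
have {}fg : f = g by apply: functional_extensionality_dep.
by subst g; congr Fock; apply: Prop_irrelevance.
Qed.

Lemma sqsummable_le (f : forall n, tensor R d n) (w : R ^nat) (B : R) :
  (forall n, sqn q (f n) <= B * w n) -> cvgn (series w) -> sqsummable q f.
Proof.
move=> fw sw; apply: (@series_le_cvg _ _ (fun n => B * w n)) => //.
- by move=> n; apply: sqn_ge0.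
- by move=> n; apply: le_trans (fw n); apply: sqn_ge0.
- exact: (@is_cvg_seriesZ _ _ B).
Qed.

Lemma series_shift (u w : R ^nat) : u 0%N = 0 -> (forall n, u n.+1 = w n) ->
  forall n, series u n.+1 = series w n.
Proof.
move=> u0 uw; elim=> [|n IH]; first by rewrite seriesSr !seriesEord /= !big_ord0 add0r.
by rewrite seriesSr IH uw -seriesSr.
Qed.

Lemma cvg_series_shift (u w : R ^nat) (l : R) : u 0%N = 0 ->
  (forall n, u n.+1 = w n) ->
  (series u @ \oo --> l) <-> (series w @ \oo --> l).
Proof.
move=> u0 uw; rewrite -(cvg_shiftS (series u)).
have -> : [sequence series u n.+1]_n = series w.
  by apply/funext => n; apply: series_shift.
by [].
Qed.

Lemma lim_series_shift (u w : R ^nat) : u 0%N = 0 ->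
  (forall n, u n.+1 = w n) -> limn (series u) = limn (series w).
Proof.
move=> u0 uw; have [cw|ncw] := pselect (cvgn (series w)).
  by apply/cvg_lim => //; apply/(cvg_series_shift _ u0 uw).
(* If one series diverges, so does the other, and both limits are the same default value. *)
rewrite (dvgP ncw) dvgP // => /cvg_ex[l ul]; apply: ncw.
by apply/cvg_ex; exists l; apply/(cvg_series_shift _ u0 uw).
Qed.

Lemma series_single (u : R ^nat) n : (forall m, m != n -> u m = 0) ->
  forall m, (n < m)%N -> series u m = u n.
Proof.
move=> un m; elim: m => // m IH; rewrite ltnS leq_eqVlt seriesSr.
case/orP => [/eqP nm|nm]; last by rewrite IH // (un m) ?addr0 // gtn_eqF.
rewrite -nm seriesEord /= big1 ?add0r // => i _.
by rewrite un // ltn_eqF.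
Qed.

Lemma cvg_series_single (u : R ^nat) n : (forall m, m != n -> u m = 0) ->
  cvgn (series u).
Proof.
move=> un; apply: (@is_cvg_near_cst _ _ (u n)).
by exists n.+1 => // m /= nm; rewrite (series_single un).
Qed.

Lemma lim_series_single (u : R ^nat) n : (forall m, m != n -> u m = 0) ->
  limn (series u) = u n.
Proof.
move=> un; apply: lim_near_cst => //.
by exists n.+1 => // m /= nm; rewrite (series_single un).
Qed.

Lemma qdot0l n (g : tensor R d n) : qdot q 0 g = 0.
Proof. by rewrite -(scale0r 0) qdotZl mul0r. Qed.

Lemma create_seq_sqsummable c v (f : forall n, tensor R d n) :
  sqsummable q f -> sqsummable q (create_seq c v f).
Proof.
move=> /cvg_ex[l fl]; pose w n := if n is m.+1 then sqn q (f m) else 0.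
apply: (@sqsummable_le _ w (create_bound q v)) => [[|n]|].
- by rewrite /= /sqn qdot0l mulr0.
- exact: sqn_create_le.
- by apply/cvg_ex; exists l; apply/(cvg_series_shift (u := w)).
Qed.

Lemma annih_seq_sqsummable c v (f : forall n, tensor R d n) :
  sqsummable q f -> sqsummable q (annih_seq c v f).
Proof.
(* Annihilation discards degree 0, so that term is set to 0 and the shift by one degree applies. *)
move=> sf; pose w n := if n is m.+1 then sqn q (f m.+1) else 0.
have /cvg_ex[l wl] : cvgn (series w).
  apply: (series_le_cvg _ _ _ sf) => [] [|n] //; exact: sqn_ge0.
have [B0 _ _] := create_boundP hq v.
apply: (@sqsummable_le _ (fun n => sqn q (f n.+1)) (create_bound q v)) => [n|].
  by apply: sqn_annih_le => //; apply: sqn_create_le.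
by apply/cvg_ex; exists l; apply/(cvg_series_shift (u := w)).
Qed.

Lemma creationE c v (f : fock d q) n : creation c v f n = create_seq c v f n.
Proof.
rewrite /creation; case: pselect => // -[].
exact/create_seq_sqsummable/component_sqsummable.
Qed.

Definition annihilation c v (f : fock d q) : fock d q :=
  Fock (@annih_seq_sqsummable c v f (@component_sqsummable R d q f)).

Lemma annihilation_adjoint c v : is_adjoint (creation c v) (annihilation c v).
Proof.
move=> f g; rewrite /fdot; congr (_ +i* _)%C;
  by apply: lim_series_shift => [|n];
     rewrite creationE /= ?qdot0l ?qdot_create.
Qed.

Lemma adjointE c v (f : fock d q) n :
  adjoint (creation c v) f n = annih_seq c v f n.
Proof.
rewrite /adjoint; case: pselect => [h|[]]; last first.
  by exists (annihilation c v); apply: annihilation_adjoint.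
case: (cid h) => B /= adjB {h}.
(* An arbitrary adjoint [B] is compared with the explicit annihilation by testing against their
   difference [h n] in degree [n] alone; pairings with this vector reduce to [qdot] in that
   degree. *)
pose h m := B f m - annih_seq c v f m.
pose g m : tensor R d m := if m == n then h m else 0.
have g0 m : m != n -> g m = 0 by rewrite /g => /negPf ->.
have sg : sqsummable q g.
  by apply: (@cvg_series_single _ n) => m /g0 ->; rewrite qdot0l.
have fdotg k : fdot (Fock sg) k = qdot q (h n) (k n).
  rewrite /fdot !(lim_series_single (n := n)) /= => [|m /g0 ->|m /g0 ->];
    rewrite ?qdot0l //.
  by rewrite /g eqxx; case: (qdot _ _ _).
have : qdot q (h n) (h n) = 0.
  rewrite {2}/h qdotDr -scaleN1r qdotZr -!fdotg.
  have := annihilation_adjoint c v (Fock sg) f; rewrite adjB !fdotg /= => ->.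
  by rewrite rmorphN rmorph1 mulN1r subrr.
by move/(qdot_eq0 hq)/eqP; rewrite subr_eq0 => /eqP.
Qed.

(** The operators on bare sequences of tensors, where linear combinations can be formed without
    carrying proofs of summability. *)
Definition S_seq c (e : exponent) v :
    (forall n, tensor R d n) -> forall n, tensor R d n :=
  if e is One then create_seq c v else annih_seq c v.

Lemma S_opE c e v (f : fock d q) n : S_op c e v f n = S_seq c e v f n.
Proof. by case: e; [exact: creationE | exact: adjointE]. Qed.

End Sequences.

(** * Words on elementary tensors *)

Section ElementaryTensors.
Variables (R : realType) (d : nat) (q : R).
Implicit Types (n : nat) (v : 'rV[R[i]]_d) (c : side).

(** Using a list of letters for all degrees at once turns creation and annihilation into operations
    on lists. *)
Definition etens (s : seq 'rV[R[i]]_d) n : tensor R d n :=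
  if size s == n then etensor (fun i : 'I_n => nth 0 s i) else 0.

Lemma etensE s n t :
  etens s n t = (size s == n)%:R * \prod_(i < n) nth 0 s i 0 (t i).
Proof. by rewrite /etens; case: eqP => _; rewrite ffunE ?mul1r ?mul0r. Qed.

Lemma etens_nil n : etens [::] n = vac_seq R d n.
Proof.
by case: n => [|n] //; apply/ffunP => t; rewrite etensE !ffunE big_ord0 mulr1.
Qed.

Lemma flip_etens s n : flip (etens s n) = etens (rev s) n.
Proof.
apply/ffunP => t; rewrite ffunE !etensE size_rev.
case: eqP => [sn|]; last by rewrite !mul0r.
congr (_ * _); rewrite (reindex_inj rev_ord_inj); apply: eq_bigr => i _.
by rewrite nth_rev ?sn // !ffunE rev_ordK.
Qed.

Lemma create_seq_etens c v s n :
  create_seq c v (etens s) n = etens (if c is Lft then v :: s else rcons s v) n.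
Proof.
case: n => [|n]; first by case: c; rewrite /etens /= ?size_rcons.
wlog -> : c s / c = Lft => [wlogL|].
  case: c; first exact: wlogL.
  rewrite /= create_flip flip_etens; have /= -> := wlogL Lft (rev s) erefl.
  by rewrite flip_etens rev_cons revK.
apply/ffunP => t; rewrite /= etensE ffunE etensE /= eqSS big_ord_recl /= mulrCA.
by congr (_ * (_ * _)); apply: eq_bigr => i _; rewrite ffunE.
Qed.

Let del (T : Type) k (s : seq T) := take k s ++ drop k.+1 s.

Lemma annihL_etens v s n :
  annihL q v (etens s n.+1) =
  \sum_(k < size s) ((q ^+ k)%:C * cdot (nth 0 s k) v) *: etens (del k s) n.
Proof.
apply/ffunP => t; rewrite ffunE sum_ffunE.
have [sn|sn] := eqVneq (size s) n.+1; last first.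
  rewrite big1 => [|k _]; last first.
    by rewrite big1 ?mulr0 // => a _; rewrite etensE (negPf sn) mul0r mulr0.
  rewrite big1 // => k _; rewrite ffunE etensE size_cat size_take size_drop ltn_ord.
  rewrite [_ == n](_ : _ = false) ?mul0r ?scaler0 //.
  by apply/negbTE; move: sn; have := ltn_ord k; lia.
rewrite sn; apply: eq_bigr => k _; rewrite ffunE etensE.
have ks : (k < size s)%N by rewrite sn ltn_ord.
have -> : size (del k s) == n.
  by rewrite size_cat size_take size_drop ks sn; have := ltn_ord k; lia.
rewrite mul1r [RHS]/GRing.scale /= -mulrA; congr (_ * _).
rewrite mulr_suml; apply: eq_bigr => a _.
rewrite etensE sn eqxx mul1r (bigD1_ord k) //= insert_at_id mulrCA mulrA.
congr (_ * _); apply: eq_bigr => j _.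
rewrite insert_at_lift /del nth_cat size_take ks /= /bump.
case: ltnP => kj; first by rewrite nth_take.
by rewrite nth_drop addSn subnKC.
Qed.

(** The labels in [s] are distinct even when vectors repeat, so the sum over places becomes a sum
    over labels. On the right, reversal turns [index k s] into the distance from the other end. *)
Lemma annih_seq_etens (I : eqType) (u : I -> 'rV[R[i]]_d) c v (s : seq I) n :
  uniq s -> annih_seq q c v (etens (map u s)) n =
  \sum_(k <- s)
    ((q ^+ (if c is Lft then index k s else size s - (index k s).+1))%:C *
     cdot (u k) v) *: etens (map u (rem k s)) n.
Proof.
have annihL_map (r : seq I) : uniq r -> annihL q v (etens (map u r) n.+1) =
    \sum_(k <- r) ((q ^+ index k r)%:C * cdot (u k) v) *: etens (map u (rem k r)) n.
  case: r => [|x0 r] ur; first by rewrite annihL_etens big_ord0 big_nil.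
  rewrite annihL_etens (big_nth x0) big_mkord size_map; apply: eq_bigr => k _.
  by rewrite (nth_map x0) // remE /del map_cat map_take map_drop !index_uniq.
move=> us; case: c; first exact: annihL_map.
rewrite /annih_seq /= flip_etens -map_rev annihL_map ?rev_uniq //.
apply/ffunP => t; rewrite ffunE !sum_ffunE.
rewrite (perm_big _ (permEl (perm_rev s))) /=; apply: eq_big_seq => k ks.
rewrite !ffunE; congr (_ *: _).
  congr ((q ^+ _)%:C * _); case: s us ks => // x0 s us ks.
  set z := x0 :: s in us ks *; have lt : (index k z < size z)%N by rewrite index_mem.
  have e : nth x0 (rev z) (size z - (index k z).+1) = k.
    by rewrite nth_rev -?subSn ?subKn ?nth_index //; lia.
  by rewrite -[X in index X (rev z)]e index_uniq ?rev_uniq ?size_rev //; lia.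
have := congr1 (fun f : tensor R d n => f t) (flip_etens (map u (rem k (rev s))) n).
rewrite /= ffunE => ->; rewrite -map_rev !rem_filter ?rev_uniq // -filter_rev.
by rewrite revK.
Qed.

End ElementaryTensors.

(** * Expansion of a word as a sum over matchings *)

Section Words.
Variables (R : realType) (d m : nat) (q : R).
Variables (chi : 'I_m -> side) (eps : 'I_m -> exponent).
Variable u : 'I_m -> 'rV[R[i]]_d.

Definition word (w : seq 'I_m) (f : forall n, tensor R d n) :
    forall n, tensor R d n :=
  foldl (fun g i => S_seq q (chi i) (eps i) (u i) g) f w.

Lemma S_seq_lin c e v a (f g : forall n, tensor R d n) n :
  S_seq q c e v (fun k => a *: f k + g k) n =
  a *: S_seq q c e v f n + S_seq q c e v g n.
Proof.
have createZ k b (x y : tensor R d k) :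
    create c v (b *: x + y) = b *: create c v x + create c v y.
  by apply/ffunP => t; rewrite !ffunE mulrDr; congr (_ + _); apply: mulrCA.
have annihLZ k b (x y : tensor R d k.+1) :
    annihL q v (b *: x + y) = b *: annihL q v x + annihL q v y.
  apply/ffunP => t; rewrite !ffunE [X in _ = X + _]mulr_sumr -big_split.
  apply: eq_bigr => j _ /=; rewrite mulrCA -mulrDr; congr (_ * _).
  rewrite mulr_sumr -big_split; apply: eq_bigr => i _ /=.
  by rewrite mulrCA -mulrDr !ffunE.
have flipZ k b (x y : tensor R d k) : flip (b *: x + y) = b *: flip x + flip y.
  by apply/ffunP => t; rewrite !ffunE.
case: e => /=; first by case: n => [|n] /=; rewrite ?scaler0 ?addr0 // createZ.
rewrite /annih_seq; case: c {createZ} => /=; first exact: annihLZ.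
by rewrite flipZ annihLZ flipZ.
Qed.

Lemma S_seq0 c e v n : S_seq q c e v (fun k => 0 : tensor R d k) n = 0.
Proof.
have := S_seq_lin c e v (-1) (fun k => 0 : tensor R d k) (fun k => 0) n.
have -> : (fun k => -1 *: 0 + 0 : tensor R d k) = fun k => 0.
  by apply: functional_extensionality_dep => k; rewrite scaler0 addr0.
by rewrite scaleN1r addNr.
Qed.

Lemma word_sum (J : Type) (r : seq J) (a : J -> R[i])
    (f : J -> forall n, tensor R d n) w n :
  word w (fun n => \sum_(j <- r) a j *: f j n) n =
  \sum_(j <- r) a j *: word w (f j) n.
Proof.
elim: w f n => //= h w IH f n; rewrite /word /= -/(word w _).
have -> : S_seq q (chi h) (eps h) (u h) (fun n => \sum_(j <- r) a j *: f j n) =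
    fun n => \sum_(j <- r) a j *: S_seq q (chi h) (eps h) (u h) (f j) n.
  apply: functional_extensionality_dep => {}n; elim: r {IH} => [|j r IH].
    rewrite big_nil -[RHS](S_seq0 (chi h) (eps h) (u h)).
    apply: (congr1 (fun f : forall k, tensor R d k => S_seq q _ _ _ f n)).
    by apply: functional_extensionality_dep => k; rewrite big_nil.
  rewrite big_cons -IH -S_seq_lin.
  apply: (congr1 (fun f : forall k, tensor R d k => S_seq q _ _ _ f n)).
  by apply: functional_extensionality_dep => k; rewrite big_cons.
exact: IH.
Qed.

Definition weight (M : seq ('I_m * 'I_m)) : R[i] :=
  (q ^+ count_pairs (crossing chi) M)%:C * \prod_(p <- M) cdot (u p.1) (u p.2).

(** Induction along [w]: an opener pushes its letter, a closer sums over the letter it removes. The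
    counting hypothesis forces the tensor to be empty at the end, which leaves a multiple of the
    vacuum. *)
Lemma word_etens (w s : seq 'I_m) n : consistent chi s w ->
  (size s + count (opener eps) w = count (closer eps) w)%N ->
  word w (etens (map u s)) n =
  (\sum_(M <- matchings chi eps w s) weight M) *: vac_seq R d n.
Proof.
elim: w s n => [|h w IH] s n c /=.
  case: s {c} => //= _; rewrite big_seq1 /weight big_nil /= mulr1 scale1r.
  exact: etens_nil.
rewrite closerN; have [oh|oh] /= := boolP (opener eps h) => sz; rewrite /word /=.
  have -> : S_seq q (chi h) (eps h) (u h) (etens (map u s)) =
            etens (map u (push chi h s)).
    apply: functional_extensionality_dep => k.
    move: oh; rewrite /opener => /eqP -> /=; rewrite create_seq_etens /push.
    by case: (chi h); rewrite ?map_rcons.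
  apply: IH; first exact: consistent_push.
  by rewrite (perm_size (perm_push chi h s)) /=; lia.
have us := consistent_uniq c.
have -> : S_seq q (chi h) (eps h) (u h) (etens (map u s)) = fun k =>
    \sum_(a <- s)
      ((q ^+ (if chi h is Lft then index a s else size s - (index a s).+1))%:C *
       cdot (u a) (u h)) *: etens (map u (rem a s)) k.
  apply: functional_extensionality_dep => k; rewrite -annih_seq_etens //.
  by move: oh; rewrite /opener; case: (eps h).
rewrite -/(word w _) word_sum big_allpairs_dep scaler_suml.
apply: eq_big_seq => k ks.
rewrite IH; last 2 first.
- exact: consistent_rem c.
- by rewrite size_rem //; case: s ks sz {c us} => //= a s _; lia.
rewrite scalerA mulr_sumr; congr (_ *: _); apply: eq_big_seq => M Mw.
(* The power of [q] from this annihilation counts the crossings of the block [(k, h)] with the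
   blocks closed later. *)
rewrite /weight big_cons /= (count_crossing c ks Mw) exprD rmorphM /=.
by rewrite mulrACA !mulrA.
Qed.
End Words.

(** * From matchings to pair partitions *)

Lemma S_word_component (R : realType) (d m : nat) (q : R) (hq : -1 < q < 1)
    (chi : 'I_m -> side) (eps : 'I_m -> exponent) (u : 'I_m -> 'rV[R[i]]_d)
    (f : fock d q) :
  S_word chi eps u f = word q chi eps u (enum 'I_m) f :> (forall n, tensor R d n).
Proof.
rewrite /S_word /word; elim: (enum 'I_m) f => //= h w IH f; rewrite IH.
apply: (congr1 (fun g : forall n, tensor R d n => word q chi eps u w g)).
by apply: functional_extensionality_dep => n; apply: S_opE.
Qed.

(** Reindexing along [partition_of]; [mem_pairs_of] identifies the pairs in the product with the
    members of [M]. *)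
Lemma sum_Phi_fiber (R : realType) (d m : nat) (q : R)
    (chi : 'I_m -> side) (eps : 'I_m -> exponent) (u : 'I_m -> 'rV[R[i]]_d) :
  \sum_(P in Phi_fiber chi eps)
     (q ^+ cr P)%:C *
     \prod_(kh : 'I_m * 'I_m |
             [&& [set kh.1; kh.2] \in s_act chi P,
                 eps kh.2 == Star & eps kh.1 == One])
       cdot (u kh.1) (u kh.2) =
  \sum_(M <- matchings chi eps (enum 'I_m) [::]) weight q chi u M.
Proof.
rewrite -big_enum (perm_big _ (perm_Phi_fiber chi eps)) big_map.
apply: eq_big_seq => M; rewrite matchingE => vM.
rewrite /weight (cr_partition_of chi vM); congr (_ * _).
rewrite [RHS]big_uniq ?(matching_uniq vM) //; apply: eq_bigl => p.
by rewrite s_act_partition_of -(mem_pairs_of vM).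
Qed.

Theorem proposition4p1p4 (R : realType) (d n : nat) (q : R)
    (eps : 'I_(2 * n) -> exponent) (chi : 'I_(2 * n) -> side)
    (u : 'I_(2 * n) -> 'rV[R[i]]_d)
    (d_gt0 : (0 < d)%N) (n_gt0 : (0 < n)%N) (hq : -1 < q < 1)
    (heps : dyck eps) :
  S_word chi eps u (vac d q) =
  fscale
    (\sum_(P in Phi_fiber chi eps)
       (q ^+ cr P)%:C *
       \prod_(kh : 'I_(2 * n) * 'I_(2 * n) |
               [&& [set kh.1; kh.2] \in s_act chi P,
                   eps kh.2 == Star & eps kh.1 == One])
         cdot (u kh.1) (u kh.2))
    (vac d q).
Proof.
rewrite sum_Phi_fiber; apply: fock_eq => k; rewrite S_word_component //.
have -> : component (vac d q) = etens (map u [::]).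
  by apply: functional_extensionality_dep => j; rewrite /= etens_nil.
rewrite word_etens ?etens_nil //; first exact: consistent_nil.
(* The equality in the Dyck property is the balance of openers and closers that [word_etens] asks
   for. *)
have cardE (P : pred 'I_(2 * n)) : #|[set i | P i]| = count P (enum 'I_(2 * n)).
  by rewrite cardsE cardE size_filter enumT.
by case: heps => _; rewrite !cardE.
Qed.
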